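(* For any $r\geq 1$ there is a finite constant $c(r)$ (independent of $n$ and $N$) such that for any $N$ with $N+1>d$, $$\sup_{n\geq 0}\left(\mathbb{E}\left(\Vert \widehat{p}_n-\widehat{P}_n\Vert^r\right)^{1/r}\vee \mathbb{E}\left(\Vert K(p_n)-K(P_n)\Vert^r\right)^{1/r}\right)\leq \frac{c(r)}{\sqrt{N}} .$$
   Context: $M'$ denotes the transpose of a matrix, $I$ the identity matrix, $a\vee b=\max(a,b)$; $\|\cdot\|$ is any fixed matrix norm (e.g. spectral or Frobenius). Model. Fix $d,d_0\ge1$, $A\in\mathbb{R}^{d\times d}$, $B\in\mathbb{R}^{d_0\times d}$, and symmetric positive definite $R\in\mathbb{R}^{d\times d}$, $R_0\in\mathbb{R}^{d_0\times d_0}$, $P_0\in\mathbb{R}^{d\times d}$. The signal-observation process is $X_{n+1}=AX_n+W_n$, $Y_n=BX_n+V_n$, $n\ge0$, where $W_n\sim\mathcal N(0,R)$, $V_n\sim\mathcal N(0,R_0)$ are independent sequences of independent variables, independent of the Gaussian variable $X_0$ which has covariance $P_0$. Put $S:=B'R_0^{-1}B$, assumed positive definite. For positive semi-definite $P$ set $K(P):=PB'(BPB'+R_0)^{-1}$ (Kalman gain), $\widehat A(P):=I-K(P)B=(I+PS)^{-1}$ and $\Phi(P):=A(I+PS)^{-1}PA'+R$. The prediction and updated Kalman covariances satisfy $P_{n+1}=\Phi(P_n)$ (started at $P_0$) and $\widehat P_n=\widehat A(P_n)P_n$. Ensemble Kalman filter. For $N\ge1$ let $\xi_0^i$, $1\le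 i\le N+1$, be independent copies of $X_0$ and let $\mathcal W_n^i\sim\mathcal N(0,R)$, $\mathcal V^i_n\sim\mathcal N(0,R_0)$ be independent, all independent of each other and of $(X_n,Y_n)_{n\ge0}$. Define for $n\ge 0$, $1\le i\le N+1$ $$\widehat\xi_n^i=\xi_n^i+K(p_n)\big(Y_n-(B\xi_n^i+\mathcal V_n^i)\big),\qquad \xi_{n+1}^i=A\widehat\xi_n^i+\mathcal W_{n+1}^i,$$ where $m_n=\frac1{N+1}\sum_i\xi_n^i$, $p_n=\frac1N\sum_{i}(\xi_n^i-m_n)(\xi_n^i-m_n)'$, and similarly $\widehat m_n=\frac1{N+1}\sum_i\widehat\xi_n^i$, $\widehat p_n=\frac1N\sum_{i}(\widehat\xi_n^i-\widehat m_n)(\widehat\xi_n^i-\widehat m_n)'$, sums over $1\le i\le N+1$. *)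

(* Defs.v *)
From HB Require Import structures.
From mathcomp Require Export all_boot all_order all_algebra.
From mathcomp Require Export all_classical all_reals all_analysis.
Set Implicit Arguments.
Unset Strict Implicit.
Unset Printing Implicit Defensive.
Import Order.TTheory GRing.Theory Num.Theory.
Import numFieldNormedType.Exports.
Local Open Scope classical_set_scope.
Local Open Scope ring_scope.

Section Matrices.
Variable R : realType.

Definition posdefmx n (M : 'M[R]_n) : Prop :=
  M^T = M /\ forall u : 'cV[R]_n, u != 0 -> 0 < (u^T *m M *m u) 0 0.

Record is_mx_norm m n (f : 'M[R]_(m, n) -> R) : Prop := {
  mx_norm_ge0 : forall M, 0 <= f M ;
  mx_norm_eq0 : forall M, f M = 0 -> M = 0 ;
  mx_normZ : forall a M, f (a *: M) = `|a| * f M ;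
  mx_normD : forall M1 M2, f (M1 + M2) <= f M1 + f M2 }.

End Matrices.

Section Random.
Context (R : realType) (disp : measure_display) (T : measurableType disp).
Variable P : probability T R.

Definition borel_cV n : set_system 'cV[R]_n := <<s [set B | open B] >>.

(* The sigma-algebra generated by [X], as a family of subsets of [T]. *)
Definition sigma_of n (X : T -> 'cV[R]_n) : set_system T :=
  [set X @^-1` B | B in @borel_cV n].

Definition random_vector n (X : T -> 'cV[R]_n) : Prop :=
  sigma_of X `<=` measurable.

(* Non-degenerate Gaussian vectors, i.e. [Sigma] is positive definite: every
   non-trivial linear form of [X] is Gaussian. The second parameter of
   [normal_prob] is the standard deviation. *)
Definition gaussian_vector n (X : T -> 'cV[R]_n) (m : 'cV[R]_n)
    (Sigma : 'M[R]_n) : Prop :=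
  random_vector X /\
  forall u : 'cV[R]_n, u != 0 -> forall B : set R, measurable B ->
    P [set w | B ((u^T *m X w) 0 0)] =
    normal_prob ((u^T *m m) 0 0) (Num.sqrt ((u^T *m Sigma *m u) 0 0)) B.

(* Finite subfamilies of [F] are presented by injections from ['I_k] to [I]. *)
Definition mutually_independent (I : Type) (F : I -> set_system T) : Prop :=
  forall (k : nat) (f : 'I_k -> I) (E : 'I_k -> set T),
    injective f -> (forall j, F (f j) (E j)) ->
    P (\bigcap_(j in [set: 'I_k]) E j) = (\prod_(j < k) P (E j))%E.

End Random.

Section Kalman.
Context (R : realType) (d d0 : nat).
(* [R1] is the covariance of the signal noise, [R0] that of the observation
   noise, [P0] that of the initial state. *)
Variables (A : 'M[R]_d) (B : 'M[R]_(d0, d)).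
Variables (R1 : 'M[R]_d) (R0 : 'M[R]_d0) (P0 : 'M[R]_d).

Definition Smx : 'M[R]_d := B^T *m invmx R0 *m B.

Definition gain (Q : 'M[R]_d) : 'M[R]_(d, d0) :=
  Q *m B^T *m invmx (B *m Q *m B^T + R0).

Definition Ahat (Q : 'M[R]_d) : 'M[R]_d := 1%:M - gain Q *m B.

Definition riccati (Q : 'M[R]_d) : 'M[R]_d :=
  A *m invmx (1%:M + Q *m Smx) *m Q *m A^T + R1.

Definition kalman_cov (n : nat) : 'M[R]_d := iter n riccati P0.

Definition kalman_cov_hat (n : nat) : 'M[R]_d :=
  Ahat (kalman_cov n) *m kalman_cov n.

Fixpoint signal (X0 : 'cV[R]_d) (W : nat -> 'cV[R]_d) (n : nat) : 'cV[R]_d :=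
  if n is k.+1 then A *m signal X0 W k + W k else X0.

Definition observation (X0 : 'cV[R]_d) (W : nat -> 'cV[R]_d)
    (V : nat -> 'cV[R]_d0) (n : nat) : 'cV[R]_d0 :=
  B *m signal X0 W n + V n.

Section Ensemble.
Variable N : nat.

Definition sample_mean (x : 'I_N.+1 -> 'cV[R]_d) : 'cV[R]_d :=
  N.+1%:R^-1 *: \sum_i x i.

Definition sample_cov (x : 'I_N.+1 -> 'cV[R]_d) : 'M[R]_d :=
  N%:R^-1 *: \sum_i (x i - sample_mean x) *m (x i - sample_mean x)^T.

Definition enkf_update (y : 'cV[R]_d0) (v : 'I_N.+1 -> 'cV[R]_d0)
    (x : 'I_N.+1 -> 'cV[R]_d) : 'I_N.+1 -> 'cV[R]_d :=
  fun i => x i + gain (sample_cov x) *m (y - (B *m x i + v i)).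

Variables (xi0 : 'I_N.+1 -> 'cV[R]_d) (cW : nat -> 'I_N.+1 -> 'cV[R]_d).
Variables (cV : nat -> 'I_N.+1 -> 'cV[R]_d0) (Y : nat -> 'cV[R]_d0).

Fixpoint enkf (n : nat) : 'I_N.+1 -> 'cV[R]_d :=
  if n is k.+1 then
    fun i => A *m enkf_update (Y k) (cV k) (enkf k) i + cW k.+1 i
  else xi0.

Definition enkf_hat (n : nat) : 'I_N.+1 -> 'cV[R]_d :=
  enkf_update (Y n) (cV n) (enkf n).

End Ensemble.
End Kalman.

(* Indices of the driving random vectors of the filter with N + 1 particles. *)
Inductive source (N : nat) : Type :=
| Src_X0
| Src_W of nat
| Src_V of nat
| Src_xi0 of 'I_N.+1
| Src_cW of nat & 'I_N.+1
| Src_cV of nat & 'I_N.+1.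

(* Joint independence of all sources says in particular that the particle noises
   are independent of (X_n, Y_n)_n, which is a function of (X0, W, V). *)
Record enkf_sources (R : realType) (d d0 : nat) (m0 : 'cV[R]_d)
    (R1 : 'M[R]_d) (R0 : 'M[R]_d0) (P0 : 'M[R]_d) (N : nat)
    (disp : measure_display) (T : measurableType disp) (P : probability T R)
    (X0 : T -> 'cV[R]_d) (W : nat -> T -> 'cV[R]_d) (V : nat -> T -> 'cV[R]_d0)
    (xi0 : 'I_N.+1 -> T -> 'cV[R]_d) (cW : nat -> 'I_N.+1 -> T -> 'cV[R]_d)
    (cV : nat -> 'I_N.+1 -> T -> 'cV[R]_d0) : Prop := {
  law_X0 : gaussian_vector P X0 m0 P0 ;
  law_W : forall n, gaussian_vector P (W n) 0 R1 ;
  law_V : forall n, gaussian_vector P (V n) 0 R0 ;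
  law_xi0 : forall i, gaussian_vector P (xi0 i) m0 P0 ;
  law_cW : forall n i, gaussian_vector P (cW n i) 0 R1 ;
  law_cV : forall n i, gaussian_vector P (cV n i) 0 R0 ;
  sources_indep : mutually_independent P (fun s : source N =>
    match s with
    | Src_X0 => sigma_of X0
    | Src_W n => sigma_of (W n)
    | Src_V n => sigma_of (V n)
    | Src_xi0 i => sigma_of (xi0 i)
    | Src_cW n i => sigma_of (cW n i)
    | Src_cV n i => sigma_of (cV n i)
    end) }.

(* [E(|f|^r)^(1/r)] as an extended real: it is [+oo] when the moment diverges. *)
Definition Lr_norm (R : realType) (disp : measure_display)
    (T : measurableType disp) (P : probability T R) (r : R) (f : T -> R) :
    \bar R :=
  ('E_P[fun w => (`|f w| `^ r)%R] `^ (r^-1)%R)%E.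

(* Main.v *)
From HB Require Import structures.
Require Import Defs.
From mathcomp Require Import ring lra measurable_realfun.
Set Implicit Arguments.
Unset Strict Implicit.
Unset Printing Implicit Defensive.
Import Order.TTheory GRing.Theory Num.Theory.
Import numFieldNormedType.Exports.
Local Open Scope classical_set_scope.
Local Open Scope ring_scope.

(** Write [U Q = (I + Q S)^-1 Q] for the updated covariance ([update_cov]), so that
    [Phi Q = A (U Q) A' + R1] is the Riccati map.

    Since [S] is positive definite, [U Q] never exceeds [S^-1], whatever [Q] is.
    Hence [U], [Ahat] and the gain are bounded over all positive semi-definite
    matrices, and, by a resolvent identity, [U] and the gain are globally
    Lipschitz. The same identity writes the difference of two Riccati orbits as
    [M1 (Q1 - Q2) M2'] with the products [M1], [M2] of the matrices [A Ahat] along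
    the orbits ([iter_riccatiB]). As [Phi Q] is bounded, its part [R1] is at least
    a fixed fraction of it; discarding [R1] at each step therefore costs a fixed
    factor, and the products decay geometrically, at a rate that depends neither
    on time nor on the starting points ([riccati_stability]).

    The sample covariances [p n] of the particles form a perturbed Riccati orbit.
    The observation shifts all particles by the same vector and disappears from
    [p n]; what is left of [p n.+1 - Phi (p n)] is a combination, with bounded
    coefficients, of two centred sample covariances and two cross-covariances of
    the fresh noises ([enkf_update_noise], [enkf_prediction_noise]). By stability
    the errors committed at past times add up with geometric weights
    ([riccati_perturbation]). So it is enough that every one-step error is of order
    [1 / sqrt N], uniformly in time. No moment of [p n] enters, because stability
    holds from arbitrary positive semi-definite matrices.

    The errors are measured in the Orlicz norm of [exp x - 1], which is stronger
    than every [L^r] norm ([orlicz_Lr]). It is forced by the cross-covariances: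
    given the past these are Gaussian, with variance proportional to the empirical
    second moment of the deviations of the particles, so exponential moments of that
    second moment are required ([orlicz_weighted_sum]). For the observation noise,
    this second moment is [Ahat p Ahat'], at most the bounded matrix [U p]. For the
    signal noise it is the updated sample covariance, that is [U p] plus the error
    of the update, just estimated in the same norm. The conditional computations
    rest on Fubini for an independent pair ([freezing]) and on the Laplace transform
    of a Gaussian exponent ([normal_prob_exp_quadratic]); the sample covariances
    reduce by polarization to empirical variances of linear forms
    ([orlicz_sample_variance]). *)

(** * Entrywise norm and quadratic forms *)

Section EntrywiseNorm.
Variable R : realType.

(** Norm of reference: it is submultiplicative and invariant under transposition in
    all dimensions, and its bounds reduce to bounds on entries. *)
Definition l1mx m n (M : 'M[R]_(m, n)) : R := \sum_i \sum_j `|M i j|.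

Lemma l1mx_ge0 m n (M : 'M[R]_(m, n)) : 0 <= l1mx M.
Proof. by apply: sumr_ge0 => i _; apply: sumr_ge0. Qed.

Lemma entry_le_l1mx m n (M : 'M[R]_(m, n)) i j : `|M i j| <= l1mx M.
Proof.
rewrite /l1mx (bigD1 i) //= (bigD1 j) //= -addrA lerDl addr_ge0 ?sumr_ge0 //.
by move=> k _; apply: sumr_ge0.
Qed.

Lemma l1mxD m n (M M' : 'M[R]_(m, n)) : l1mx (M + M') <= l1mx M + l1mx M'.
Proof.
rewrite /l1mx -big_split; apply: ler_sum => i _; rewrite -big_split.
by apply: ler_sum => j _; rewrite mxE ler_normD.
Qed.

Lemma l1mxN m n (M : 'M[R]_(m, n)) : l1mx (- M) = l1mx M.
Proof.
by apply: eq_bigr => i _; apply: eq_bigr => j _; rewrite mxE normrN.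
Qed.

Lemma l1mxB m n (M M' : 'M[R]_(m, n)) : l1mx (M - M') <= l1mx M + l1mx M'.
Proof. by rewrite -(l1mxN M') l1mxD. Qed.

Lemma l1mx_tr m n (M : 'M[R]_(m, n)) : l1mx M^T = l1mx M.
Proof.
rewrite /l1mx exchange_big; apply: eq_bigr => i _.
by apply: eq_bigr => j _; rewrite mxE.
Qed.

Lemma l1mxM m n k (M : 'M[R]_(m, n)) (M' : 'M[R]_(n, k)) :
  l1mx (M *m M') <= l1mx M * l1mx M'.
Proof.
rewrite /l1mx mulr_suml; apply: ler_sum => i _.
apply: (@le_trans _ _ (\sum_j \sum_l `|M i l| * `|M' l j|)).
  apply: ler_sum => j _; rewrite mxE; apply: le_trans (ler_norm_sum _ _ _) _.
  by apply: ler_sum => l _; rewrite normrM.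
rewrite exchange_big mulr_suml; apply: ler_sum => l _ /=.
rewrite -mulr_sumr ler_wpM2l //.
rewrite (bigD1 l) //= lerDl; apply: sumr_ge0 => ? _; exact: sumr_ge0.
Qed.

Lemma l1mx_le_entries m n (M : 'M[R]_(m, n)) c :
  (forall i j, `|M i j| <= c) -> l1mx M <= (m * n)%:R * c.
Proof.
move=> Mc; apply: le_trans (_ : _ <= \sum_(i < m) \sum_(j < n) c) _.
  by apply: ler_sum => i _; apply: ler_sum => j _.
by rewrite !sumr_const !card_ord -mulrnA mulnC mulr_natl.
Qed.

(** Expansion in the elementary matrices and the triangle inequality. *)
Lemma is_mx_norm_le_l1mx m n (f : 'M[R]_(m, n) -> R) : is_mx_norm f ->
  exists2 c : R, 0 < c & forall M, f M <= c * l1mx M.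
Proof.
move=> fP; have f0 := mx_norm_ge0 fP.
pose c := 1 + \sum_i \sum_j f (delta_mx i j).
have cij i j : f (delta_mx i j) <= c.
  rewrite /c (bigD1 i) //= (bigD1 j) //=.
  set x := \sum_(_ | _) _; set y := \sum_(_ | _) _.
  have x0 : 0 <= x by apply: sumr_ge0.
  have y0 : 0 <= y by apply: sumr_ge0 => k _; apply: sumr_ge0.
  lra.
exists c => [|M].
  by rewrite ltr_pwDl // sumr_ge0 // => i _; rewrite sumr_ge0.
have fsum (I : finType) (F : I -> 'M[R]_(m, n)) :
    f (\sum_i F i) <= \sum_i f (F i).
  apply: (big_ind2 (fun x y => f x <= y)) => //.
    by rewrite -(scale0r 0) (mx_normZ fP) normr0 mul0r.
  by move=> *; apply: le_trans (mx_normD fP _ _) (lerD _ _).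
rewrite {1}(matrix_sum_delta M) /l1mx mulr_sumr; apply: le_trans (fsum _ _) _.
apply: ler_sum => i _; rewrite mulr_sumr; apply: le_trans (fsum _ _) _.
by apply: ler_sum => j _; rewrite (mx_normZ fP) mulrC ler_wpM2r.
Qed.

End EntrywiseNorm.

Section QuadraticForms.
Variable R : realType.

Definition qform n (M : 'M[R]_n) (u : 'cV[R]_n) : R := (u^T *m M *m u) 0 0.

Definition psdmx n (M : 'M[R]_n) : Prop :=
  M^T = M /\ forall u, 0 <= qform M u.

Lemma qformD n (M M' : 'M[R]_n) u : qform (M + M') u = qform M u + qform M' u.
Proof. by rewrite /qform mulmxDr mulmxDl mxE. Qed.

Lemma qformN n (M : 'M[R]_n) u : qform (- M) u = - qform M u.
Proof. by rewrite /qform mulmxN mulNmx mxE. Qed.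

Lemma qformZ n a (M : 'M[R]_n) u : qform (a *: M) u = a * qform M u.
Proof. by rewrite /qform -scalemxAr -scalemxAl mxE. Qed.

Lemma qform_congr n k (M : 'M[R]_k) (L : 'M[R]_(n, k)) u :
  qform (L *m M *m L^T) u = qform M (L^T *m u).
Proof. by rewrite /qform trmx_mul trmxK !mulmxA. Qed.

Lemma qform1E n (u : 'cV[R]_n) : qform 1%:M u = \sum_i (u i 0) ^+ 2.
Proof.
by rewrite /qform mulmx1 mxE; apply: eq_bigr => i _; rewrite mxE expr2.
Qed.

Lemma qform_gram n (u x : 'cV[R]_n) : qform (x *m x^T) u = ((u^T *m x) 0 0) ^+ 2.
Proof.
rewrite /qform mulmxA -mulmxA mxE big_ord1 expr2; congr (_ * _).
have <- : ((x^T *m u)^T) 0 0 = (x^T *m u) 0 0 by rewrite mxE.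
by rewrite trmx_mul trmxK.
Qed.

Lemma qform1_ge0 n (u : 'cV[R]_n) : 0 <= qform 1%:M u.
Proof. by rewrite qform1E; apply: sumr_ge0 => i _; apply: sqr_ge0. Qed.

Lemma sqr_entry_le_qform1 n (u : 'cV[R]_n) i : u i 0 ^+ 2 <= qform 1%:M u.
Proof.
by rewrite qform1E (bigD1 i) //= lerDl sumr_ge0 // => *; apply: sqr_ge0.
Qed.

Lemma qform_delta n (M : 'M[R]_n) i : qform M (delta_mx i 0) = M i i.
Proof. by rewrite /qform trmx_delta -rowE -colE !mxE. Qed.

Lemma qform1_delta n (i : 'I_n) : qform (1%:M : 'M[R]_n) (delta_mx i 0) = 1.
Proof. by rewrite qform_delta mxE eqxx. Qed.

(** Carries estimates on linear forms of random vectors over to the entries of their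
    covariance matrices. *)
Lemma entry_polarize n (M : 'M[R]_n) i j : M^T = M ->
  M i j = 2^-1 * (qform M (delta_mx i 0 + delta_mx j 0)
          - qform M (delta_mx i 0) - qform M (delta_mx j 0)).
Proof.
move=> Ms; rewrite !qform_delta /qform [(_ + _)^T]linearD /= !mulmxDl !mulmxDr.
rewrite !trmx_delta -!rowE -!colE !mxE.
have -> : M j i = M i j by rewrite -{1}Ms mxE.
by field.
Qed.

Lemma qform_le_l1mx n (M : 'M[R]_n) u : qform M u <= l1mx M * qform 1%:M u.
Proof.
rewrite {1}/qform -mulmxA mxE /l1mx mulr_suml; apply: ler_sum => i _.
rewrite !mxE mulr_sumr mulr_suml; apply: ler_sum => j _.
have hi := sqr_entry_le_qform1 u i; have hj := sqr_entry_le_qform1 u j.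
apply: le_trans (ler_norm _) _; rewrite mulrCA normrM ler_wpM2l //.
have : `|u i 0 * u j 0| <= 2^-1 * (u i 0 ^+ 2 + u j 0 ^+ 2).
  have h1 := sqr_ge0 (u i 0 - u j 0); have h2 := sqr_ge0 (u i 0 + u j 0).
  by rewrite ler_norml; apply/andP; split; nra.
by move/le_trans; apply; lra.
Qed.

Lemma psdmxD n (M M' : 'M[R]_n) : psdmx M -> psdmx M' -> psdmx (M + M').
Proof.
move=> [Ms M0] [M's M'0]; split=> [|u]; first by rewrite linearD /= Ms M's.
by rewrite qformD addr_ge0.
Qed.

Lemma psdmx_congr n k (M : 'M[R]_k) (L : 'M[R]_(n, k)) :
  psdmx M -> psdmx (L *m M *m L^T).
Proof.
move=> [Ms M0]; split=> [|u]; first by rewrite !trmx_mul trmxK Ms mulmxA.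
by rewrite qform_congr.
Qed.

Lemma posdefmx_psd n (M : 'M[R]_n) : posdefmx M -> psdmx M.
Proof.
move=> [Ms M0]; split=> // u; have [->|/M0/ltW//] := eqVneq u 0.
by rewrite /qform mulmx0 mxE.
Qed.

Lemma posdefmxDl n (M M' : 'M[R]_n) : psdmx M -> posdefmx M' ->
  posdefmx (M + M').
Proof.
move=> [Ms M0] [M's M'0]; split=> [|u /M'0]; first by rewrite linearD /= Ms M's.
by rewrite -!/(qform _ _) qformD; apply: ltr_wpDl.
Qed.

Lemma posdefmx_unit n (M : 'M[R]_n) : posdefmx M -> M \in unitmx.
Proof.
move=> [Ms M0]; rewrite -row_free_unit -kermx_eq0; apply/rowV0P => v /sub_kermxP vM.
apply/eqP/negPn/negP => v0; have /M0 : v^T != 0 by rewrite -trmx0 (inj_eq trmx_inj).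
by rewrite trmxK vM mul0mx mxE ltxx.
Qed.

(** Cauchy-Schwarz for the inner product of [M], applied to [u] and [M^-1 u],
    turns positivity into a quantitative lower bound. *)
Lemma posdefmx_lower n (M : 'M[R]_n) : posdefmx M ->
  exists2 c : R, 0 < c & forall u, c * qform 1%:M u <= qform M u.
Proof.
move=> Mpd; have Mu := posdefmx_unit Mpd; have [Ms M0] := Mpd.
have l0 := l1mx_ge0 (invmx M).
exists (1 + l1mx (invmx M))^-1 => [|u]; first by rewrite invr_gt0; lra.
rewrite mulrC ler_pdivrMr; last lra.
have [->|u0] := eqVneq u 0; first by rewrite /qform !mulmx0 mxE mul0r.
have Q0 : 0 < qform M u by apply: M0.
pose y := invmx M *m u.
have yu : M *m y = u by rewrite mulmxA mulmxV // mul1mx.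
have y0 : y != 0 by apply: contra_neq u0; rewrite -yu => ->; rewrite mulmx0.
have Y0 : 0 < qform M y by apply: M0.
have Yle : qform M y <= l1mx (invmx M) * qform 1%:M u.
  apply: le_trans (qform_le_l1mx _ _); rewrite /qform -mulmxA yu.
  by rewrite /y trmx_mul trmx_inv Ms.
have : 0 <= qform M (qform M y *: u - qform 1%:M u *: y).
  exact: (posdefmx_psd Mpd).2.
have uMy : (u^T *m M *m y) 0 0 = qform 1%:M u by rewrite -mulmxA yu /qform mulmx1.
have yMu : (y^T *m M *m u) 0 0 = qform 1%:M u.
  by rewrite -{1}Ms -trmx_mul yu /qform mulmx1.
set X := qform M u in Q0 *; set Y := qform M y in Y0 Yle *.
set Z := qform 1%:M u in Yle uMy yMu *.
have -> : qform M (Y *: u - Z *: y) = Y * (Y * X - Z ^+ 2).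
  have tr : (Y *: u - Z *: y)^T = Y *: u^T - Z *: y^T by rewrite linearB /= !linearZ.
  rewrite /qform tr mulmxBl mulmxBl !mulmxBr.
  rewrite -!scalemxAl -!scalemxAr.
  have uMu : (u^T *m M *m u) 0 0 = X by [].
  have yMy : (y^T *m M *m y) 0 0 = Y by [].
  move: (u^T *m M *m y) (y^T *m M *m u) (u^T *m M *m u) (y^T *m M *m y)
    uMy yMu uMu yMy => a b c e aE bE cE eE.
  by rewrite !mxE aE bE cE eE; ring.
rewrite pmulr_rge0 // subr_ge0 => ZYX.
have Z0 : 0 <= Z by apply: qform1_ge0.
have [->|Zn] := eqVneq Z 0; first by nra.
have {}Z0 : 0 < Z by rewrite lt_neqAle eq_sym Zn.
have : Z * Z <= Z * (l1mx (invmx M) * X).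
  by rewrite -expr2; apply: le_trans ZYX _; rewrite mulrCA mulrA ler_wpM2r // ltW.
rewrite ler_pM2l //; nra.
Qed.

End QuadraticForms.

(** * The Kalman update and the stability of the Riccati flow *)

Section KalmanAlgebra.
Context (R : realType) (d d0 : nat).
Variables (A : 'M[R]_d) (B : 'M[R]_(d0, d)) (R1 : 'M[R]_d) (R0 : 'M[R]_d0).
Hypotheses (R1_pd : posdefmx R1) (R0_pd : posdefmx R0)
  (S_pd : posdefmx (Smx B R0)).

Local Notation S := (Smx B R0).
Local Notation gain := (gain B R0).
Local Notation Ahat := (Ahat B R0).
Local Notation Phi := (riccati A B R1 R0).

(** Equal to [(I + Q S)^-1 Q], by [invmx_D1S]. *)
Definition update_cov (Q : 'M[R]_d) : 'M[R]_d := Ahat Q *m Q.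

Lemma innovation_cov_unit Q : psdmx Q -> B *m Q *m B^T + R0 \in unitmx.
Proof.
by move=> Q0; apply: posdefmx_unit; apply: posdefmxDl => //; apply: psdmx_congr.
Qed.

Lemma gain_innovation Q : psdmx Q -> gain Q *m (B *m Q *m B^T + R0) = Q *m B^T.
Proof. by move=> Q0; rewrite mulmxKV // innovation_cov_unit. Qed.

(** Woodbury identity, a consequence of [K (B Q B' + R0) = Q B'] alone. *)
Lemma Ahat_mulD1S Q : psdmx Q -> Ahat Q *m (1%:M + Q *m S) = 1%:M.
Proof.
move=> Q0; have R0u := posdefmx_unit R0_pd.
have KB : gain Q *m B *m Q *m B^T = Q *m B^T - gain Q *m R0.
  by rewrite -(gain_innovation Q0) mulmxDr !mulmxA addrK.
have KBS : gain Q *m B *m (Q *m S) = Q *m S - gain Q *m B.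
  by rewrite /Smx !mulmxA KB 2!mulmxBl (mulmxK R0u).
rewrite /Ahat mulmxDr mulmx1 mulmxBl mul1mx KBS.
by rewrite opprB [Q *m S + _]addrCA subrr addr0 subrK.
Qed.

Lemma invmx_D1S Q : psdmx Q -> invmx (1%:M + Q *m S) = Ahat Q.
Proof.
move=> Q0; have Qu : 1%:M + Q *m S \in unitmx.
  by have [] := mulmx1_unit (Ahat_mulD1S Q0).
by rewrite -[RHS](mulmxK Qu) Ahat_mulD1S // mul1mx.
Qed.

Lemma riccatiE Q : psdmx Q -> Phi Q = A *m update_cov Q *m A^T + R1.
Proof. by move=> Q0; rewrite /riccati invmx_D1S // /update_cov !mulmxA. Qed.

Lemma tr_Smx : S^T = S. Proof. exact: S_pd.1. Qed.

Lemma trAhat_mulD1S Q : psdmx Q -> (1%:M + S *m Q) *m (Ahat Q)^T = 1%:M.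
Proof.
move=> Q0; have := congr1 trmx (Ahat_mulD1S Q0).
by rewrite trmx_mul linearD /= trmx_mul tr_Smx Q0.1 trmx1.
Qed.

(** [Q] may be singular, so symmetry is read off from the push-through identity
    [(I + Q S) Q = Q (I + S Q)] rather than from [(Q^-1 + S)^-1]. *)
Lemma tr_update_cov Q : psdmx Q -> (update_cov Q)^T = update_cov Q.
Proof.
move=> Q0; rewrite trmx_mul Q0.1.
have push (S' Q' L : 'M[R]_d) :
    (1%:M + Q' *m S') *m (Q' *m L) = Q' *m ((1%:M + S' *m Q') *m L).
  by rewrite !mulmxDl !mul1mx mulmxDr !mulmxA.
transitivity (Ahat Q *m (1%:M + Q *m S) *m (Q *m (Ahat Q)^T)).
  by rewrite Ahat_mulD1S // mul1mx.
by rewrite -mulmxA push trAhat_mulD1S // mulmx1.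
Qed.

Lemma AhatE Q : psdmx Q -> Ahat Q = 1%:M - update_cov Q *m S.
Proof.
move=> Q0; apply/eqP; rewrite eq_sym subr_eq; apply/eqP.
by rewrite -(Ahat_mulD1S Q0) mulmxDr mulmx1 /update_cov mulmxA.
Qed.

(** Resolvent identity. The two factors [Ahat] make the iterates telescope into
    products. *)
Lemma update_covB Q1 Q2 : psdmx Q1 -> psdmx Q2 ->
  update_cov Q1 - update_cov Q2 = Ahat Q1 *m (Q1 - Q2) *m (Ahat Q2)^T.
Proof.
move=> Q10 Q20.
have -> : Q1 - Q2 = Q1 *m (1%:M + S *m Q2) - (1%:M + Q1 *m S) *m Q2.
  rewrite mulmxDr mulmxDl mulmx1 mul1mx !mulmxA opprD.
  by rewrite addrACA subrr addr0.
rewrite mulmxBr mulmxBl (mulmxA (Ahat Q1) (1%:M + _)) Ahat_mulD1S // mul1mx.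
rewrite -(mulmxA (Ahat Q1)) -(mulmxA Q1) trAhat_mulD1S // mulmx1.
by rewrite -(tr_update_cov Q20) trmx_mul Q20.1.
Qed.

Lemma gainE Q : psdmx Q -> gain Q = update_cov Q *m B^T *m invmx R0.
Proof.
move=> Q0; have R0u := posdefmx_unit R0_pd.
rewrite -[LHS](mulmxK R0u); congr (_ *m _).
have /(congr1 (fun X => X - gain Q *m (B *m Q *m B^T))) := gain_innovation Q0.
rewrite mulmxDr addrC addKr => ->.
by rewrite /update_cov /Ahat !mulmxBl mul1mx !mulmxA.
Qed.

(** Joseph's form of the update: it is manifestly positive, and it matches term by
    term the covariance of an updated particle [Ahat x - K v + K y]. *)
Lemma update_cov_joseph Q : psdmx Q ->
  update_cov Q =
  Ahat Q *m Q *m (Ahat Q)^T + gain Q *m R0 *m (gain Q)^T.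
Proof.
move=> Q0; have R0u := posdefmx_unit R0_pd.
have -> : gain Q *m R0 = update_cov Q *m B^T by rewrite {1}gainE // mulmxKV.
rewrite -/(update_cov Q) -mulmxA -mulmxDr.
by rewrite /Ahat linearB /= trmx1 trmx_mul subrK mulmx1.
Qed.

Lemma psd_update_cov Q : psdmx Q -> psdmx (update_cov Q).
Proof.
move=> Q0; rewrite update_cov_joseph //; apply: psdmxD; apply: psdmx_congr => //.
exact: posdefmx_psd.
Qed.

Lemma psd_riccati Q : psdmx Q -> psdmx (Phi Q).
Proof.
move=> Q0; rewrite riccatiE //; apply: psdmxD; last exact: posdefmx_psd.
exact/psdmx_congr/psd_update_cov.
Qed.

(** [U S U <= U] for [U := update_cov Q]: the update never exceeds [S^-1]. *)
Lemma update_cov_le Q u : psdmx Q ->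
  qform S (update_cov Q *m u) <= qform (update_cov Q) u.
Proof.
move=> Q0; rewrite -subr_ge0.
have := qform_congr S (update_cov Q) u; rewrite tr_update_cov // => <-.
rewrite -qformN -qformD.
have -> : update_cov Q - update_cov Q *m S *m update_cov Q =
   Ahat Q *m Q *m (Ahat Q)^T.
  rewrite -[X in X - _]mul1mx -mulmxBl -AhatE // -{1}(tr_update_cov Q0).
  by rewrite trmx_mul Q0.1 mulmxA.
exact: (psdmx_congr _ Q0).2.
Qed.

(** With [s I <= S], the inequality [U S U <= U] gives [s U_kj^2 <= U_jj], which
    bounds the diagonal entries first, then all others. *)
Lemma update_cov_bounded :
  exists2 c : R, 0 < c & forall Q, psdmx Q -> l1mx (update_cov Q) <= c.
Proof.
have [s s0 Ss] := posdefmx_lower S_pd.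
have sV : 0 < s^-1 by rewrite invr_gt0.
exists ((d * d)%:R * s^-1 + 1); first by apply: ltr_wpDl => //; apply: mulr_ge0 => //; exact: ltW.
move=> Q Q0; set U := update_cov Q.
apply: le_trans (_ : _ <= (d * d)%:R * s^-1) _; last by rewrite lerDl.
apply: l1mx_le_entries => i j.
have Uj k : s * U k j ^+ 2 <= U j j.
  have := update_cov_le (delta_mx j 0) Q0.
  rewrite qform_delta -/U; apply: le_trans.
  apply: le_trans (Ss _); rewrite ler_pM2l // -colE.
  by have := sqr_entry_le_qform1 (col j U) k; rewrite [col j U k 0]mxE.
have Ujj : 0 <= U j j by rewrite -qform_delta; apply: (psd_update_cov Q0).2.
have Ujjs : U j j <= s^-1.
  rewrite -[leRHS]mul1r ler_pdivlMr //; have := Uj j; rewrite expr2 mulrA.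
  have [->|Un] := eqVneq (U j j) 0; first by rewrite mul0r.
  by rewrite ger_pMl ?lt_neqAle 1?eq_sym ?Un // mulrC.
have Uij : U i j ^+ 2 <= s^-1 ^+ 2.
  rewrite -(ler_pM2l s0); apply: le_trans (Uj i) _.
  by rewrite expr2 mulrA divff ?mul1r // gt_eqF.
by rewrite -(@ler_pXn2r _ 2%N) ?nnegrE ?(ltW sV) // real_normK // num_real.
Qed.

Lemma Ahat_bounded :
  exists2 c : R, 0 < c & forall Q, psdmx Q -> l1mx (Ahat Q) <= c.
Proof.
have [c c0 Uc] := update_cov_bounded.
have S0 := l1mx_ge0 S; have I0 := l1mx_ge0 (1%:M : 'M[R]_d).
exists (l1mx (1%:M : 'M[R]_d) + c * l1mx S + 1) => [|Q Q0].
  by apply: ltr_wpDl => //; apply: addr_ge0 => //; apply: mulr_ge0 => //; exact: ltW.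
rewrite AhatE //; apply: le_trans (l1mxB _ _) _.
have : l1mx (update_cov Q *m S) <= c * l1mx S.
  by apply: le_trans (l1mxM _ _) _; apply: ler_wpM2r => //; apply: Uc.
by move=> h; rewrite -addrA lerD // (le_trans h) // lerDl.
Qed.

Lemma gain_bounded :
  exists2 c : R, 0 < c & forall Q, psdmx Q -> l1mx (gain Q) <= c.
Proof.
have [c c0 Uc] := update_cov_bounded.
have B0 := l1mx_ge0 (B^T *m invmx R0).
exists (c * l1mx (B^T *m invmx R0) + 1) => [|Q Q0].
  by apply: ltr_wpDl => //; apply: mulr_ge0 => //; exact: ltW.
rewrite gainE // -mulmxA; apply: le_trans (l1mxM _ _) _.
by rewrite (@le_trans _ _ (c * l1mx (B^T *m invmx R0))) ?lerDl // ler_wpM2r // Uc.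
Qed.

Lemma update_cov_lipschitz : exists2 c : R, 0 < c & forall Q1 Q2,
  psdmx Q1 -> psdmx Q2 ->
  l1mx (update_cov Q1 - update_cov Q2) <= c * l1mx (Q1 - Q2).
Proof.
have [c c0 Ac] := Ahat_bounded.
exists (c * c) => [|Q1 Q2 Q10 Q20]; first exact: mulr_gt0.
rewrite update_covB //; apply: le_trans (l1mxM _ _) _.
rewrite l1mx_tr mulrAC ler_pM ?l1mx_ge0 ?Ac //.
by apply: le_trans (l1mxM _ _) _; rewrite ler_pM ?l1mx_ge0 ?Ac.
Qed.

Lemma gain_lipschitz : exists2 c : R, 0 < c & forall Q1 Q2,
  psdmx Q1 -> psdmx Q2 -> l1mx (gain Q1 - gain Q2) <= c * l1mx (Q1 - Q2).
Proof.
have [c c0 Uc] := update_cov_lipschitz.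
have B0 := l1mx_ge0 (B^T *m invmx R0).
exists (c * (l1mx (B^T *m invmx R0) + 1)) => [|Q1 Q2 Q10 Q20].
  by apply: mulr_gt0 => //; apply: ltr_wpDl.
rewrite !gainE // -!(mulmxA (update_cov _)) -mulmxBl; apply: le_trans (l1mxM _ _) _.
rewrite mulrAC ler_pM ?l1mx_ge0 // ?Uc //; lra.
Qed.

(** Product of the matrices [A Ahat] along the orbit of [Q], the transition matrix
    of the linearized flow. The flow itself is governed by these products, exactly
    and not only to first order, by [iter_riccatiB]. *)
Fixpoint riccati_transition (n : nat) (Q : 'M[R]_d) : 'M[R]_d :=
  if n is k.+1 then A *m Ahat (iter k Phi Q) *m riccati_transition k Q
  else 1%:M.

Lemma psd_iter_riccati n Q : psdmx Q -> psdmx (iter n Phi Q).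
Proof. by move=> Q0; elim: n => //= n; apply: psd_riccati. Qed.

Lemma riccatiB Q1 Q2 : psdmx Q1 -> psdmx Q2 ->
  Phi Q1 - Phi Q2 = A *m Ahat Q1 *m (Q1 - Q2) *m (A *m Ahat Q2)^T.
Proof.
move=> Q10 Q20; rewrite !riccatiE // opprD addrACA subrr addr0.
by rewrite -mulmxBl -mulmxBr update_covB // trmx_mul !mulmxA.
Qed.

Lemma iter_riccatiB n Q1 Q2 : psdmx Q1 -> psdmx Q2 ->
  iter n Phi Q1 - iter n Phi Q2 =
  riccati_transition n Q1 *m (Q1 - Q2) *m (riccati_transition n Q2)^T.
Proof.
move=> Q10 Q20; elim: n => [|n IH] /=; first by rewrite trmx1 mul1mx mulmx1.
rewrite riccatiB ?IH; try exact: psd_iter_riccati.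
by rewrite [in RHS]trmx_mul !mulmxA.
Qed.

(** Joseph's form, from which the positive term in the gain is dropped. *)
Lemma riccati_ge Q u : psdmx Q ->
  qform (A *m Ahat Q *m Q *m (A *m Ahat Q)^T) u + qform R1 u <= qform (Phi Q) u.
Proof.
move=> Q0; rewrite riccatiE // qformD lerD2r update_cov_joseph // mulmxDr mulmxDl.
have -> : A *m Ahat Q *m Q *m (A *m Ahat Q)^T =
    A *m (Ahat Q *m Q *m (Ahat Q)^T) *m A^T by rewrite trmx_mul !mulmxA.
rewrite qformD lerDl.
exact: (psdmx_congr A (psdmx_congr (gain Q) (posdefmx_psd R0_pd))).2.
Qed.

Lemma riccati_bounded : exists2 b : R, 0 < b & forall Q u, psdmx Q ->
  qform (Phi Q) u <= b * qform 1%:M u.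
Proof.
have [c c0 Uc] := update_cov_bounded.
have A0 := l1mx_ge0 A; have R10 := l1mx_ge0 R1.
pose b := 1 + l1mx A * c * l1mx A + l1mx R1.
exists b => [|Q u Q0].
  by rewrite /b -addrA ltr_pwDl // addr_ge0 // !mulr_ge0 // ltW.
apply: le_trans (qform_le_l1mx _ _) _.
apply: ler_wpM2r; first exact: qform1_ge0.
rewrite riccatiE //; apply: le_trans (l1mxD _ _) _; rewrite /b lerD2r.
apply: (@le_trans _ _ (l1mx A * c * l1mx A)); last by rewrite lerDr.
apply: le_trans (l1mxM _ _) _; rewrite l1mx_tr ler_wpM2r //.
by apply: le_trans (l1mxM _ _) _; rewrite ler_wpM2l // Uc.
Qed.

(** [R1 >= s I >= (s / b) (Phi Q)]: removing [R1] from [Phi Q] costs at least a fixed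
    fraction of it. *)
Lemma riccati_contracts : exists2 rho : R, 0 < rho < 1 & forall Q u, psdmx Q ->
  qform (A *m Ahat Q *m Q *m (A *m Ahat Q)^T) u <= rho * qform (Phi Q) u.
Proof.
have [b' b'0 Phib'] := riccati_bounded.
have [s s0 R1s] := posdefmx_lower R1_pd.
(* The slack [2 * s] keeps the ratio [s / b] below one half. *)
pose b := b' + 2 * s.
have b0 : 0 < b by rewrite addr_gt0 // mulr_gt0.
have Phib Q u : psdmx Q -> qform (Phi Q) u <= b * qform 1%:M u.
  move=> /(Phib' Q u) /le_trans; apply; rewrite ler_wpM2r ?qform1_ge0 //.
  by rewrite lerDl mulr_ge0 // ltW.
have sb0 : 0 < s / b by rewrite divr_gt0.
have sb1 : s / b <= 2^-1 by rewrite ler_pdivrMr // /b; lra.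
exists (1 - s / b) => [|Q u Q0]; first by apply/andP; split; lra.
have := riccati_ge u Q0; have := R1s u; have := Phib Q u Q0.
move: (qform 1%:M u) (qform (Phi Q) u) (qform R1 u) => x y z yx xz.
rewrite -lerBrDr => /le_trans; apply.
rewrite mulrBl mul1r lerB // (le_trans _ xz) // mulrAC ler_pdivrMr //.
by rewrite -mulrA ler_pM2l // mulrC.
Qed.

(** Iterating the contraction, [M Q M' <= rho^n (Phi^n Q)] for the product [M] of
    length [n] along the orbit of [Q]. Started from [Phi Q >= R1 >= s I], the left
    side dominates [s M M'], and the right side is bounded; hence constants that are
    uniform over singular and over large [Q]. *)
Lemma riccati_transition_decay : exists2 rho : R, 0 < rho < 1 &
  exists2 c : R, 0 < c & forall n Q i j, psdmx Q ->
  riccati_transition n (Phi Q) i j ^+ 2 <= c * rho ^+ n.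
Proof.
have [rho rho01 contr] := riccati_contracts; exists rho => //.
have rho0 : 0 <= rho by case/andP: rho01 => /ltW.
have [b b0 Phib] := riccati_bounded.
have [s s0 R1s] := posdefmx_lower R1_pd.
have step n Q u : psdmx Q ->
    qform (riccati_transition n Q *m Q *m (riccati_transition n Q)^T) u <=
    rho ^+ n * qform (iter n Phi Q) u.
  move=> Q0; elim: n u => [|n IH] u /=; first by rewrite trmx1 mul1mx mulmx1 mul1r.
  rewrite [(_ *m riccati_transition n Q)^T]trmx_mul !mulmxA.
  have -> : A *m Ahat (iter n Phi Q) *m riccati_transition n Q *m Q *m
      (riccati_transition n Q)^T *m (A *m Ahat (iter n Phi Q))^T =
      A *m Ahat (iter n Phi Q) *m (riccati_transition n Q *m Q *m
      (riccati_transition n Q)^T) *m (A *m Ahat (iter n Phi Q))^T.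
    by rewrite !mulmxA.
  rewrite qform_congr; apply: le_trans (IH _) _; rewrite exprSr -mulrA.
  rewrite ler_wpM2l ?exprn_ge0 // -qform_congr; apply: contr.
  exact: psd_iter_riccati.
exists (b / s) => [|n Q i j Q0]; first by rewrite divr_gt0.
set M := riccati_transition n (Phi Q).
have PQ0 := psd_riccati Q0.
have := step n (Phi Q) (delta_mx i 0) PQ0; rewrite qform_congr -/M.
have -> : iter n Phi (Phi Q) = Phi (iter n Phi Q) by rewrite -iterS iterSr.
have := Phib (iter n Phi Q) (delta_mx i 0) (psd_iter_riccati n Q0).
rewrite qform1_delta mulr1 => h1 h2.
have h3 : qform R1 (M^T *m delta_mx i 0) <= qform (Phi Q) (M^T *m delta_mx i 0).
  rewrite (riccatiE Q0) qformD lerDr.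
  exact: (psdmx_congr A (psd_update_cov Q0)).2.
have h4 : M i j ^+ 2 <= qform 1%:M (M^T *m delta_mx i 0).
  by apply: le_trans (sqr_entry_le_qform1 _ j); rewrite -colE !mxE.
rewrite mulrAC ler_pdivlMr // mulrC.
apply: le_trans (_ : s * qform 1%:M (M^T *m delta_mx i 0) <= _).
  by rewrite ler_pM2l.
apply: le_trans (R1s _) (le_trans h3 (le_trans h2 _)).
by rewrite mulrC ler_wpM2r ?exprn_ge0.
Qed.

(** The first step of the flow makes the covariances bounded and bounded away from
    zero; it has the bounded factors [A Ahat], and the decay of the products takes
    over from there. *)
Theorem riccati_stability : exists2 rho : R, 0 < rho < 1 & exists2 c : R, 0 < c &
  forall n Q1 Q2, psdmx Q1 -> psdmx Q2 ->
  l1mx (iter n Phi Q1 - iter n Phi Q2) <= c * rho ^+ n * l1mx (Q1 - Q2).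
Proof.
have [rho rho01 [c c0 decay]] := riccati_transition_decay; exists rho => //.
have [rho0 rho1] := andP rho01.
have [a a0 Aa] := Ahat_bounded.
have A0 := l1mx_ge0 A.
(* The summand [1] covers [n = 0]; the division by [rho] pays for the first step,
   during which nothing is contracted. *)
pose k := 1 + (d * d)%:R * c * (l1mx A * a) ^+ 2 / rho.
have k1 : 1 <= k.
  rewrite lerDl divr_ge0 ?(ltW rho0) // mulr_ge0 ?exprn_ge0 ?mulr_ge0 //.
    exact: ltW.
  exact: ltW.
exists k => [|n Q1 Q2 Q10 Q20]; first exact: lt_le_trans k1.
case: n => [|n].
  by rewrite expr0 mulr1 -[leLHS]mul1r ler_wpM2r // l1mx_ge0.
rewrite !iterSr iter_riccatiB; try exact: psd_riccati.
set M1 := riccati_transition n (Phi Q1); set M2 := riccati_transition n (Phi Q2).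
set D := Phi Q1 - Phi Q2.
have Dle : l1mx D <= (l1mx A * a) ^+ 2 * l1mx (Q1 - Q2).
  rewrite /D riccatiB // expr2 mulrAC.
  have Aal Q : psdmx Q -> l1mx (A *m Ahat Q) <= l1mx A * a.
    by move=> Q0; apply: le_trans (l1mxM _ _) _; rewrite ler_wpM2l // Aa.
  apply: le_trans (l1mxM _ _) _; rewrite l1mx_tr ler_pM ?l1mx_ge0 ?Aal //.
  by apply: le_trans (l1mxM _ _) _; rewrite ler_wpM2r ?l1mx_ge0 ?Aal.
have crho : 0 <= c * rho ^+ n by rewrite mulr_ge0 ?exprn_ge0 // ltW.
have MM i j k' l : `|M1 i k' * M2 j l| <= c * rho ^+ n.
  have h1 := decay n Q1 i k' Q10; have h2 := decay n Q2 j l Q20.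
  have h3 := sqr_ge0 (M1 i k' - M2 j l); have h4 := sqr_ge0 (M1 i k' + M2 j l).
  move: h1 h2 h3 h4; rewrite -/M1 -/M2 ler_norml => h1 h2 h3 h4.
  by apply/andP; split; nra.
have : l1mx (M1 *m D *m M2^T) <= (d * d)%:R * (c * rho ^+ n * l1mx D).
  apply: l1mx_le_entries => i j; rewrite mxE.
  apply: le_trans (ler_norm_sum _ _ _) _.
  rewrite /l1mx exchange_big mulr_sumr; apply: ler_sum => l _ /=.
  rewrite !mxE mulr_suml mulr_sumr; apply: le_trans (ler_norm_sum _ _ _) _.
  apply: ler_sum => k' _; rewrite mulrAC normrM ler_wpM2r //.
move/le_trans; apply.
have -> : k * rho ^+ n.+1 * l1mx (Q1 - Q2) = rho ^+ n.+1 * l1mx (Q1 - Q2) +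
   (d * d)%:R * (c * rho ^+ n * ((l1mx A * a) ^+ 2 * l1mx (Q1 - Q2))).
  by rewrite /k [rho ^+ n.+1]exprS; field; rewrite gt_eqF.
rewrite -[leLHS]add0r; apply: lerD.
  by rewrite mulr_ge0 ?l1mx_ge0 // exprn_ge0 // ltW.
by rewrite ler_wpM2l // ler_wpM2l.
Qed.

End KalmanAlgebra.

(** * Sample covariances and the decomposition of the ensemble noise *)

Section SampleCovariance.
Context (R : realType) (N : nat).

Definition cross_cov m k (x : 'I_N.+1 -> 'cV[R]_m) (y : 'I_N.+1 -> 'cV[R]_k) :
    'M[R]_(m, k) :=
  N%:R^-1 *: \sum_i (x i - sample_mean x) *m (y i - sample_mean y)^T.

Lemma sum_sample_dev m (x : 'I_N.+1 -> 'cV[R]_m) :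
  \sum_i (x i - sample_mean x) = 0.
Proof.
rewrite sumrB sumr_const card_ord -scaler_nat /sample_mean scalerA.
by rewrite divff ?scale1r ?subrr // pnatr_eq0.
Qed.

Lemma sample_dev_affine m k l (L : 'M[R]_(l, m)) (M : 'M[R]_(l, k)) (c : 'cV[R]_l)
    (x : 'I_N.+1 -> 'cV[R]_m) (y : 'I_N.+1 -> 'cV[R]_k) z i :
  (forall i, z i = L *m x i + M *m y i + c) ->
  z i - sample_mean z = L *m (x i - sample_mean x) + M *m (y i - sample_mean y).
Proof.
move=> zE.
have -> : sample_mean z = L *m sample_mean x + M *m sample_mean y + c.
  rewrite /sample_mean; under eq_bigr do rewrite zE.
  rewrite !big_split /= sumr_const card_ord !scalerDr -[c *+ _]scaler_nat.
  rewrite [_ *: (_ *: c)]scalerA mulVf ?scale1r ?pnatr_eq0 //.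
  by rewrite -!mulmx_sumr !scalemxAr.
by rewrite zE !mulmxBr opprD addrACA subrr addr0 opprD addrACA.
Qed.

(** Deviations sum to zero, so the second sample may stay uncentred: each [y i] then
    appears as a separate independent factor. *)
Lemma cross_covE m k (x : 'I_N.+1 -> 'cV[R]_m) (y : 'I_N.+1 -> 'cV[R]_k) :
  cross_cov x y = N%:R^-1 *: \sum_i (x i - sample_mean x) *m (y i)^T.
Proof.
congr (_ *: _); under eq_bigr do rewrite linearB /= mulmxBr.
by rewrite sumrB -mulmx_suml sum_sample_dev mul0mx subr0.
Qed.

Lemma tr_cross_cov m k (x : 'I_N.+1 -> 'cV[R]_m) (y : 'I_N.+1 -> 'cV[R]_k) :
  (cross_cov x y)^T = cross_cov y x.
Proof.
rewrite /cross_cov linearZ /= linear_sum /=; congr (_ *: _).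
by apply: eq_bigr => i _; rewrite trmx_mul trmxK.
Qed.

Lemma sample_covE m (x : 'I_N.+1 -> 'cV[R]_m) : sample_cov x = cross_cov x x.
Proof. by []. Qed.

(** The common shift [c] disappears; this is how the observation leaves the recursion
    of the sample covariances. *)
Lemma sample_cov_affine m k l (L : 'M[R]_(l, m)) (M : 'M[R]_(l, k)) (c : 'cV[R]_l)
    (x : 'I_N.+1 -> 'cV[R]_m) (y : 'I_N.+1 -> 'cV[R]_k) z :
  (forall i, z i = L *m x i + M *m y i + c) ->
  sample_cov z = L *m sample_cov x *m L^T + M *m sample_cov y *m M^T
    + (L *m cross_cov x y *m M^T + (L *m cross_cov x y *m M^T)^T).
Proof.
move=> zE; rewrite !trmx_mul trmxK tr_cross_cov !mulmxA /sample_cov /cross_cov.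
rewrite -!(scalemxAl, scalemxAr) -!scalerDr; congr (_ *: _).
rewrite !mulmx_sumr !mulmx_suml -!big_split; apply: eq_bigr => i _ /=.
rewrite (sample_dev_affine _ zE).
move: (x i - _) (y i - _) => u v; rewrite linearD /= !trmx_mul.
rewrite mulmxDl !mulmxDr !mulmxA.
move: (L *m u *m u^T *m _) (M *m v *m v^T *m _) (L *m u *m v^T *m _)
  (M *m v *m u^T *m _) => a b e f.
by apply/matrixP => ? ?; rewrite !mxE; ring.
Qed.

Lemma qform_sample_cov m (x : 'I_N.+1 -> 'cV[R]_m) u :
  qform (sample_cov x) u =
  N%:R^-1 * \sum_i ((u^T *m (x i - sample_mean x)) 0 0) ^+ 2.
Proof.
rewrite /sample_cov qformZ; congr (_ * _).
rewrite /qform mulmx_sumr mulmx_suml summxE.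
by apply: eq_bigr => i _; rewrite -qform_gram.
Qed.

Lemma psd_sample_cov m (x : 'I_N.+1 -> 'cV[R]_m) : psdmx (sample_cov x).
Proof.
split=> [|u]; first by rewrite sample_covE tr_cross_cov.
rewrite qform_sample_cov mulr_ge0 ?invr_ge0 ?ler0n // sumr_ge0 // => i _.
exact: sqr_ge0.
Qed.

Lemma sample_cov_diag m (x : 'I_N.+1 -> 'cV[R]_m) j :
  sample_cov x j j = N%:R^-1 * \sum_i ((x i - sample_mean x) j 0) ^+ 2.
Proof.
rewrite -qform_delta qform_sample_cov; congr (_ * _); apply: eq_bigr => i _.
by rewrite trmx_delta -rowE mxE.
Qed.

Lemma cross_cov_entry m k (x : 'I_N.+1 -> 'cV[R]_m) (y : 'I_N.+1 -> 'cV[R]_k)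
  a b : cross_cov x y a b =
  N%:R^-1 * \sum_i (x i - sample_mean x) a 0 * y i b 0.
Proof.
rewrite cross_covE mxE summxE; congr (_ * _); apply: eq_bigr => i _.
by rewrite mxE big_ord1 [_^T _ _]mxE.
Qed.

End SampleCovariance.

Section NoiseDecomposition.
Context (R : realType) (d d0 N : nat).
Variables (A : 'M[R]_d) (B : 'M[R]_(d0, d)) (R1 : 'M[R]_d) (R0 : 'M[R]_d0).
Hypothesis R0_pd : posdefmx R0.

Local Notation gain := (gain B R0).
Local Notation Ahat := (Ahat B R0).

Lemma enkf_updateE y v (x : 'I_N.+1 -> 'cV[R]_d) i :
  enkf_update B R0 y v x i =
  Ahat (sample_cov x) *m x i + (- gain (sample_cov x)) *m v i
   + gain (sample_cov x) *m y.
Proof.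
rewrite /enkf_update /Ahat mulmxBl mul1mx mulmxBr mulmxDr mulNmx mulmxA.
move: (gain _ *m y) (gain _ *m B *m _) (gain _ *m v i) => a b e.
by apply/matrixP => ? ?; rewrite !mxE; ring.
Qed.

(** The updated covariance in Joseph's form cancels the means of the terms of
    [sample_cov_affine]; centred fluctuations remain. *)
Lemma sample_cov_enkf_update y v (x : 'I_N.+1 -> 'cV[R]_d) :
  let p := sample_cov x in
  let C := Ahat p *m cross_cov x v *m (gain p)^T in
  sample_cov (enkf_update B R0 y v x) - update_cov B R0 p =
  gain p *m (sample_cov v - R0) *m (gain p)^T - (C + C^T).
Proof.
set p := sample_cov x => /=; have p0 : psdmx p by apply: psd_sample_cov.
rewrite update_cov_joseph // (sample_cov_affine (enkf_updateE y v x)) -/p.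
have trN m n (M : 'M[R]_(m, n)) : (- M)^T = - M^T by rewrite linearN.
rewrite (trN _ _ (gain p)) mulmxN (mulNmx (gain p)) mulNmx opprK.
rewrite (mulmxN (Ahat p *m _)) trN -opprD mulmxBr.
rewrite (mulmxBl (gain p *m _)) opprD.
move: (Ahat p *m p *m _) (_ *m cross_cov x v *m _) => X C.
move: (gain p *m _ *m _) (gain p *m R0 *m _) => a b.
by apply/matrixP => ? ?; rewrite !mxE; ring.
Qed.

Lemma sample_cov_prediction w (x : 'I_N.+1 -> 'cV[R]_d) :
  let C := A *m cross_cov x w in
  sample_cov (fun i => A *m x i + w i) - (A *m sample_cov x *m A^T + R1) =
  (sample_cov w - R1) + (C + C^T).
Proof.
move=> C; have zE i : A *m x i + w i = A *m x i + 1%:M *m w i + 0.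
  by rewrite mul1mx addr0.
rewrite (sample_cov_affine zE) /C {C zE}.
move: (sample_cov w) (cross_cov x w) (sample_cov x) => W C p.
rewrite trmx1 !mulmx1 mul1mx; move: (A *m C) (A *m _ *m _) => {}C a.
by apply/matrixP => ? ?; rewrite !mxE; ring.
Qed.

End NoiseDecomposition.

Section NoiseBounds.
Context (R : realType) (d d0 : nat).
Variables (A : 'M[R]_d) (B : 'M[R]_(d0, d)) (R1 : 'M[R]_d) (R0 : 'M[R]_d0).
Hypotheses (R0_pd : posdefmx R0) (S_pd : posdefmx (Smx B R0)).

Local Notation gain := (gain B R0).
Local Notation Ahat := (Ahat B R0).

(** [Ahat] is kept inside the cross term: the vectors [Ahat (x i - mean)] have a
    bounded second moment, whereas the deviations of [x] are not under control. *)
Lemma enkf_update_noise : exists2 c : R, 0 < c & forall N y v (x : 'I_N.+1 -> 'cV[R]_d),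
  l1mx (sample_cov (enkf_update B R0 y v x) - update_cov B R0 (sample_cov x)) <=
  c * (l1mx (sample_cov v - R0) + l1mx (Ahat (sample_cov x) *m cross_cov x v)).
Proof.
have [k k0 gk] := gain_bounded R0_pd S_pd.
exists (2 * k + k * k) => [|N y v x].
  by rewrite addr_gt0 // mulr_gt0.
have gp := gk _ (psd_sample_cov x).
rewrite (sample_cov_enkf_update _ R0_pd); apply: le_trans (l1mxB _ _) _.
set p := sample_cov x in gp *; set V := _ - R0; set C := Ahat p *m cross_cov x v.
have h1 : l1mx (gain p *m V *m (gain p)^T) <= k * k * l1mx V.
  apply: le_trans (l1mxM _ _) _; rewrite l1mx_tr mulrAC ler_pM ?l1mx_ge0 //.
  by apply: le_trans (l1mxM _ _) _; rewrite ler_pM ?l1mx_ge0.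
have h2 : l1mx (C *m (gain p)^T) <= k * l1mx C.
  apply: le_trans (l1mxM _ _) _; rewrite l1mx_tr mulrC ler_pM ?l1mx_ge0 //.
have := l1mxD (C *m (gain p)^T) (C *m (gain p)^T)^T; rewrite l1mx_tr => h3.
have V0 := l1mx_ge0 V; have C0 := l1mx_ge0 C; nra.
Qed.

Lemma enkf_prediction_noise : exists2 c : R, 0 < c & forall N y v w (x : 'I_N.+1 -> 'cV[R]_d),
  let z := enkf_update B R0 y v x in
  l1mx (sample_cov (fun i => A *m z i + w i) - riccati A B R1 R0 (sample_cov x)) <=
  c * (l1mx (sample_cov v - R0) + l1mx (Ahat (sample_cov x) *m cross_cov x v) +
       l1mx (sample_cov w - R1) + l1mx (cross_cov z w)).
Proof.
have [k k0 nk] := enkf_update_noise; have A0 := l1mx_ge0 A.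
exists (l1mx A * k * l1mx A + 2 * l1mx A + 1) => [|N y v w x /=].
  by rewrite ltr_wpDl // addr_ge0 // !mulr_ge0 // ltW.
rewrite riccatiE //; last exact: psd_sample_cov.
have := nk N y v x; set z := enkf_update _ _ _ _ _; set U := update_cov _ _ _ => nz.
have -> : sample_cov (fun i => A *m z i + w i) - (A *m U *m A^T + R1) =
  A *m (sample_cov z - U) *m A^T + (sample_cov w - R1 +
    (A *m cross_cov z w + (A *m cross_cov z w)^T)).
  rewrite -sample_cov_prediction mulmxBr mulmxBl.
  move: (A *m _ *m _) (A *m sample_cov z *m _) (sample_cov _) => a b e.
  by apply/matrixP => ? ?; rewrite !mxE; ring.
apply: le_trans (l1mxD _ _) _.
move: nz; set V := _ + l1mx (_ *m _); set W := sample_cov w - R1; set C := cross_cov z w => nz.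
have h1 : l1mx (A *m (sample_cov z - U) *m A^T) <= l1mx A * k * l1mx A * V.
  apply: le_trans (l1mxM _ _) _; rewrite l1mx_tr mulrAC ler_pM ?l1mx_ge0 //.
  by apply: le_trans (l1mxM _ _) _; rewrite -mulrA ler_wpM2l.
have h2 : l1mx (A *m C) <= l1mx A * l1mx C by apply: l1mxM.
have := l1mxD W (A *m C + (A *m C)^T).
have := l1mxD (A *m C) (A *m C)^T; rewrite l1mx_tr => h3 h4.
have V0 : 0 <= V by rewrite addr_ge0 ?l1mx_ge0.
have C0 := l1mx_ge0 C; have W0 := l1mx_ge0 W.
have h5 : 0 <= l1mx A * k * l1mx A by rewrite !mulr_ge0 // ltW.
set x1 := l1mx (A *m (sample_cov z - U) *m A^T) in h1 *.
set x2 := l1mx (_ + _) in h4 *.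
nra.
Qed.

End NoiseBounds.

(** * Gaussian integrals and freezing *)

Section GaussianIntegrals.
Variable R : realType.
Implicit Types m s a t : R.

(** Change of measure by the Radon-Nikodym derivative, which coincides almost
    everywhere with the density. *)
Lemma ge0_integral_normal_prob m s (f : R -> \bar R) :
  measurable_fun setT f -> (forall x, (0 <= f x)%E) ->
  (\int[normal_prob m s]_x f x =
   \int[lebesgue_measure]_x (f x * (normal_pdf m s x)%:E))%E.
Proof.
move=> mf f0.
have dom := @normal_prob_dominates R m s.
rewrite -(Radon_Nikodym_SigmaFinite.change_of_variables dom) //.
have mpdf : measurable_fun setT (fun x => (normal_pdf m s x)%:E).
  by apply/measurable_EFinP; exact: measurable_normal_pdf.
have int := Radon_Nikodym_SigmaFinite.f_integrable dom.
apply: ae_eq_integral => //.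
- by apply: emeasurable_funM => //; exact: (measurable_int _ int).
- exact: emeasurable_funM.
- apply: ae_eqe_mul2l; apply: integral_ae_eq => //.
  by move=> E _ mE; rewrite -(Radon_Nikodym_SigmaFinite.f_integral dom).
Qed.

(** Completing the square: the tilted Gaussian density is a multiple of another
    Gaussian density. *)
Lemma normal_prob_exp_quadratic m s a t : 0 < s -> 0 < 1 - 2 * a * s ^+ 2 ->
  (\int[normal_prob m s]_x (expR (a * (x - m) ^+ 2 + t * (x - m)))%:E =
  (expR (t ^+ 2 * s ^+ 2 / (2 * (1 - 2 * a * s ^+ 2))) /
   Num.sqrt (1 - 2 * a * s ^+ 2))%:E)%E.
Proof.
move=> s0; set w := 1 - _ => w0.
have sn0 : s != 0 by rewrite gt_eqF.
have wn0 : w != 0 by rewrite gt_eqF.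
have sw0 : 0 < Num.sqrt w by rewrite sqrtr_gt0.
pose s' := s / Num.sqrt w; have s'0 : 0 < s' by rewrite divr_gt0.
pose m' := m + t * s ^+ 2 / w.
have mexp : measurable_fun setT (fun x : R => expR (a * (x - m) ^+ 2 + t * (x - m))).
  apply: measurableT_comp => //; apply: measurable_funD.
    by apply: measurable_funM => //; apply: measurable_funX; apply: measurable_funB.
  by apply: measurable_funM => //; apply: measurable_funB.
rewrite ge0_integral_normal_prob; last 2 first.
- exact/measurable_EFinP.
- by move=> x; rewrite lee_fin expR_ge0.
set c := _ / Num.sqrt w.
transitivity (\int[lebesgue_measure]_x (c%:E * (normal_pdf m' s' x)%:E))%E; last first.
  rewrite ge0_integralZl_EFin //=.
  - by rewrite integral_normal_pdf mule1.
  - by move=> x _; rewrite lee_fin normal_pdf_ge0.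
  - by apply/measurable_EFinP; exact: measurable_normal_pdf.
  - by rewrite divr_ge0 ?expR_ge0 // ltW.
apply: eq_integral => x _; rewrite -!EFinM; congr (_%:E).
rewrite !normal_pdfE ?gt_eqF // /normal_fun.
have pk : normal_peak s' = Num.sqrt w * normal_peak s.
  rewrite /normal_peak /s' expr_div_n sqr_sqrtr ?(ltW w0) //.
  have -> : s ^+ 2 / w * pi *+ 2 = w^-1 * (s ^+ 2 * pi *+ 2).
    by rewrite !mulr2n; ring.
  by rewrite sqrtrM ?invr_ge0 ?(ltW w0) // sqrtrV ?(ltW w0) // invfM invrK.
have cE (y : R) : c * (normal_peak s' * y) =
    normal_peak s * (expR (t ^+ 2 * s ^+ 2 / (2 * w)) * y).
  by rewrite pk /c; field; rewrite gt_eqF.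
rewrite cE mulrCA; congr (_ * _); rewrite -!expRD; congr expR.
rewrite /m' /s' expr_div_n sqr_sqrtr ?(ltW w0) //.
rewrite -[s ^+ 2 *+ 2]mulr_natr -[s ^+ 2 / w *+ 2]mulr_natr.
have wE : a = (1 - w) / (2 * s ^+ 2) by rewrite /w; field.
rewrite {1}wE; field.
by rewrite sn0 wn0.
Qed.

End GaussianIntegrals.

Section Freezing.
Context {dT : measure_display} {T : measurableType dT} {R : realType}.
Variable P : probability T R.

(** The product rule on the pi-system [G] determines independence of [h] from the
    sigma-algebra that [G] generates. *)
Record indep_of (G : set_system T) (h : T -> R) : Prop := {
  indep_setI : setI_closed G ;
  indep_setT : G setT ;
  indep_meas : G `<=` measurable ;
  indep_mfun : measurable_fun setT h ;
  indep_prod : forall E B, G E -> measurable B ->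
    P (E `&` h @^-1` B) = (P E * P (h @^-1` B))%E }.

Variables (G : set_system T) (h : T -> R) (m s : R).
Hypothesis Gh : indep_of G h.
Hypothesis h_law : forall B, measurable B -> P (h @^-1` B) = normal_prob m s B.

Local Notation GT := (g_sigma_algebraType G).
Local Notation RT := (measurableTypeR R).

Let Gmeas (E : set T) : <<s G >> E -> measurable E.
Proof.
exact: (smallest_sub (@sigma_algebra_measurable _ T) (indep_meas Gh)).
Qed.

Let mid : measurable_fun setT (idfun : T -> GT).
Proof. by move=> _ E mE; rewrite setTI; apply: Gmeas. Qed.

Let idm : {mfun T >-> GT} := HB.pack (idfun : T -> GT) (isMeasurableFun.Build _ _ _ _ _ mid).

Lemma measurable_fun_sub (d' : measure_display) (T' : measurableType d')
  (f : GT -> T') : measurable_fun setT f -> measurable_fun setT (f : T -> T').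
Proof.
move=> mf _ B mB; rewrite setTI; apply: Gmeas.
have := mf measurableT B mB; rewrite setTI; exact.
Qed.

Let pair_h (w : T) : GT * RT := (w, h w).

Let mpair_h : measurable_fun [set: T] pair_h.
Proof. by apply: measurable_fun_pair; [exact: mid|exact: indep_mfun Gh]. Qed.

Let graph : {mfun T >-> (GT * RT)%type} :=
  HB.pack pair_h (isMeasurableFun.Build _ _ _ _ _ mpair_h).

(* [E |-> P (E and h in B)] and [E |-> P E * P (h in B)] are finite measures that agree
   on the pi-system [G]. *)
Let indep_sigma (E : set T) (B : set R) : <<s G >> E -> measurable B ->
  P (E `&` h @^-1` B) = (P E * normal_prob m s B)%E.
Proof.
move=> GE mB; rewrite -h_law //.
have mhB : measurable (h @^-1` B).
  by rewrite -[X in measurable X]setTI; exact: (indep_mfun Gh).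
have r0 : 0 <= fine (P (h @^-1` B)) by apply: fine_ge0.
pose m1 := mrestr P mhB.
pose m2 := mscale (NngNum r0) P.
have m2E A : m2 A = (P A * P (h @^-1` B))%E.
  by rewrite /m2 /mscale /= fineK ?fin_num_measure // muleC.
have -> : P (E `&` h @^-1` B) = m1 E by [].
rewrite -m2E; apply: (g_sigma_algebra_measure_unique G _ (fun=> setT)) => //.
- exact: indep_meas Gh.
- by move=> _; exact: indep_setT Gh.
- by rewrite bigcup_const.
- exact: indep_setI Gh.
- move=> A GA; rewrite -[RHS]/(m2 A) m2E; exact: (indep_prod Gh GA mB).
- by move=> _; rewrite -[X in (X < _)%E]/(P (setT `&` h @^-1` B)) setTI (le_lt_trans (probability_le1 P mhB)) // ltry.
Qed.

(** Fubini for an independent pair: the [G]-measurable part can be frozen while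
    [h] is integrated out. *)
Lemma freezing (f : GT * RT -> \bar R) : measurable_fun setT f ->
  (forall z, (0 <= f z)%E) ->
  (\int[P]_w f (w, h w) = \int[P]_w \int[normal_prob m s]_x f (w : GT, x))%E.
Proof.
move=> mf f0.
transitivity (\int[distribution P graph]_z f z)%E.
  by rewrite ge0_integral_distribution.
transitivity (\int[distribution P idm \x normal_prob m s]_z f z)%E.
  apply: eq_measure_integral => E mE _; apply/esym.
  exact: (@product_measure_unique _ _ _ _ _ (distribution P idm)
    (normal_prob m s) (distribution P graph) indep_sigma _ mE).
rewrite fubini_tonelli1 // ge0_integral_distribution //.
- exact: measurable_fun_fubini_tonelli_F.
- by move=> y; apply: integral_ge0 => x _; apply: f0.
Qed.

(** The slope [t] of the exponent may be random, as long as it is frozen together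
    with [F]. *)
Lemma gaussian_freezing a (F t : GT -> R) : 0 < s -> 0 < 1 - 2 * a * s ^+ 2 ->
  measurable_fun setT F -> measurable_fun setT t -> (forall w, 0 <= F w) ->
  (\int[P]_w (F w * expR (a * (h w - m) ^+ 2 + t w * (h w - m)))%:E =
   \int[P]_w (F w * (expR (t w ^+ 2 * s ^+ 2 / (2 * (1 - 2 * a * s ^+ 2))) /
   Num.sqrt (1 - 2 * a * s ^+ 2)))%:E)%E.
Proof.
move=> s0 w0 mF mt F0.
pose f (z : GT * RT) := (F z.1 * expR (a * (z.2 - m) ^+ 2 + t z.1 * (z.2 - m)))%:E.
have mz : measurable_fun setT (fun z : GT * RT => z.2 - m).
  apply: measurable_funB => //; exact: (@measurable_snd _ _ GT RT).
have mf : measurable_fun setT f.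
  apply/measurable_EFinP; apply: measurable_funM.
    by apply: (measurableT_comp mF); exact: measurable_fst.
  apply: measurableT_comp => //; apply: measurable_funD.
    by apply: measurable_funM => //; apply: measurable_funX.
  apply: measurable_funM => //.
  by apply: (measurableT_comp mt); exact: measurable_fst.
have f0 z : (0 <= f z)%E by rewrite lee_fin mulr_ge0 ?expR_ge0.
have /= := freezing mf f0; rewrite /f /= => ->.
apply: eq_integral => w _.
under eq_integral do rewrite EFinM.
rewrite ge0_integralZl_EFin //.
- by rewrite normal_prob_exp_quadratic // -EFinM.
- apply/measurable_EFinP; apply: measurableT_comp => //; apply: measurable_funD.
    by apply: measurable_funM => //; apply: measurable_funX; apply: measurable_funB.
  by apply: measurable_funM => //; apply: measurable_funB.
Qed.

End Freezing.

(** * Exponential Orlicz norm *)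

Section OrliczNorm.
Context {dT : measure_display} {T : measurableType dT} {R : realType}.
Variable P : probability T R.
Implicit Types (f g : T -> R) (a b c k : R).

(** The integral of a non-negative function is a supremum over the simple functions
    below it, hence monotone for arbitrary functions, measurable or not. *)
Lemma le_ge0_integral (f g : T -> \bar R) : (forall x, (0 <= f x)%E) ->
  (forall x, (f x <= g x)%E) -> (\int[P]_x f x <= \int[P]_x g x)%E.
Proof.
move=> f0 fg; have g0 x : (0 <= g x)%E by exact: le_trans (fg x).
rewrite !ge0_integralTE //; apply: le_ereal_sup => _ [h hf <-]; exists h => //.
by move=> x; apply: le_trans (hf x) (fg x).
Qed.

Lemma ge0_integral_lincomb a b (F G : T -> R) : 0 <= a -> 0 <= b ->
  measurable_fun setT F -> measurable_fun setT G ->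
  (forall w, 0 <= F w) -> (forall w, 0 <= G w) ->
  (\int[P]_w (a * F w + b * G w)%:E =
   a%:E * \int[P]_w (F w)%:E + b%:E * \int[P]_w (G w)%:E)%E.
Proof.
move=> a0 b0 mF mG F0 G0.
have mF' : measurable_fun setT (EFin \o F) by apply/measurable_EFinP.
have mG' : measurable_fun setT (EFin \o G) by apply/measurable_EFinP.
under eq_integral do rewrite EFinD 2!EFinM.
rewrite ge0_integralD //=; first last.
- by apply: measurable_funeM.
- by move=> w _; rewrite -EFinM lee_fin mulr_ge0.
- by apply: measurable_funeM.
- by move=> w _; rewrite -EFinM lee_fin mulr_ge0.
by rewrite !ge0_integralZl_EFin //; move=> w _; rewrite lee_fin.
Qed.

(** Convexity of the exponential, from its tangent at the weighted mean [z]. *)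
Lemma expR_weighted a b x y : 0 < a -> 0 < b ->
  expR ((x + y) / (a + b)) <=
  a / (a + b) * expR (x / a) + b / (a + b) * expR (y / b).
Proof.
move=> a0 b0; have ab0 : 0 < a + b by rewrite addr_gt0.
set z := (x + y) / (a + b).
have tangent u : expR z * (1 + (u - z)) <= expR u.
  have -> : u = z + (u - z) by rewrite addrC subrK.
  by rewrite expRD ler_pM2l ?expR_gt0 // addrAC subrr add0r expR_ge1Dx.
have ha : 0 < a / (a + b) by rewrite divr_gt0.
have hb : 0 < b / (a + b) by rewrite divr_gt0.
apply: le_trans (lerD (ler_wpM2l (ltW ha) (tangent (x / a)))
  (ler_wpM2l (ltW hb) (tangent (y / b)))).
rewrite le_eqVlt; apply/orP; left; apply/eqP.
by rewrite /z; field; rewrite !gt_eqF.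
Qed.

(** [orlicz f k]: the Orlicz norm of [f] for [exp x - 1] is at most [k]. Using a
    measurable majorant frees [f] itself from measurability. *)
Definition orlicz f k : Prop := exists2 g : T -> R, measurable_fun setT g &
  (forall w, expR (`|f w| / k) <= g w) /\ (\int[P]_w (g w)%:E <= 2%:E)%E.

Lemma orlicz_dom f g k : (forall w, `|f w| <= `|g w|) -> 0 < k ->
  orlicz g k -> orlicz f k.
Proof.
move=> fg k0 [h mh [gh h2]]; exists h => //; split=> // w.
by apply: le_trans (gh w); rewrite ler_expR ler_pM2r ?invr_gt0.
Qed.

Lemma orliczZ f c k : 0 < c -> 0 < k -> orlicz f k ->
  orlicz (fun w => c * f w) (c * k).
Proof.
move=> c0 k0 [h mh [fh h2]]; exists h => //; split=> // w.
apply: le_trans (fh w); rewrite ler_expR normrM (ger0_norm (ltW c0)) invfM.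
by rewrite mulrACA divff ?gt_eqF // mul1r.
Qed.

Lemma orlicz_mono f k k' : 0 < k -> k <= k' -> orlicz f k -> orlicz f k'.
Proof.
move=> k0 kk' [h mh [fh h2]]; exists h => //; split=> // w.
apply: le_trans (fh w); rewrite ler_expR ler_wpM2l // lef_pV2 // posrE //.
exact: lt_le_trans kk'.
Qed.

Lemma orlicz0 k : orlicz (fun=> 0) k.
Proof.
exists (fun=> 1) => //; split=> [w|]; first by rewrite normr0 mul0r expR0.
by rewrite integral_cst //= probability_setT mule1 lee_fin; lra.
Qed.

(** Triangle inequality, from convexity with weights [a / (a + b)] and
    [b / (a + b)]. *)
Lemma orliczD f g a b : 0 < a -> 0 < b -> orlicz f a -> orlicz g b ->
  orlicz (fun w => `|f w| + `|g w|) (a + b).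
Proof.
move=> a0 b0 [F mF [fF F2]] [G mG [gG G2]].
have ab0 : 0 < a + b by rewrite addr_gt0.
have F0 w : 0 <= F w by apply: le_trans (fF w); apply: expR_ge0.
have G0 w : 0 <= G w by apply: le_trans (gG w); apply: expR_ge0.
have ha : 0 < a / (a + b) by rewrite divr_gt0.
have hb : 0 < b / (a + b) by rewrite divr_gt0.
exists (fun w => a / (a + b) * F w + b / (a + b) * G w).
  by apply: measurable_funD; apply: measurable_funM.
split=> [w|].
  rewrite ger0_norm ?addr_ge0 //.
  apply: le_trans (expR_weighted _ _ a0 b0) _.
  by apply: lerD; rewrite ler_pM2l.
rewrite ge0_integral_lincomb ?(ltW ha) ?(ltW hb) //.
have -> : 2%:E = ((a / (a + b))%:E * 2%:E + (b / (a + b))%:E * 2%:E :> \bar R)%E.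
  by rewrite -!EFinM -EFinD; congr (_%:E); field; rewrite gt_eqF.
by apply: leeD; rewrite lee_pmul2l.
Qed.

(** The summand [e] keeps the bound positive when [s] is empty. *)
Lemma orlicz_sum (I : Type) (s : seq I) (f : I -> T -> R) (k : I -> R) :
  (forall i, 0 < k i) -> (forall i, orlicz (f i) (k i)) -> forall e, 0 < e ->
  orlicz (fun w => \sum_(i <- s) `|f i w|) (e + \sum_(i <- s) k i).
Proof.
move=> k0 fk; elim: s => [|i s IH] e e0.
  by under eq_fun do rewrite big_nil; apply: orlicz0.
have s0 : 0 <= \sum_(j <- s) k j by apply: sumr_ge0 => j _; apply: ltW.
have es0 : 0 < e + \sum_(j <- s) k j by rewrite ltr_pwDl.
rewrite big_cons addrCA; have := orliczD (k0 i) es0 (fk i) (IH e e0).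
apply: orlicz_dom => [w|]; last by rewrite addr_gt0.
rewrite big_cons [X in _ <= `|_ + X|]ger0_norm //.
exact: sumr_ge0.
Qed.

(** A bound [C] on an exponential moment becomes the bound [2] after dividing the
    exponent by [C], since [exp (x / C) <= 1 - 1 / C + exp x / C]. *)
Lemma orlicz_intro f k C : 0 < k -> 1 <= C -> measurable_fun setT f ->
  (\int[P]_w (expR (`|f w| / k))%:E <= C%:E)%E -> orlicz f (C * k).
Proof.
move=> k0 C1 mf fC; have C0 : 0 < C by exact: lt_le_trans C1.
have mE : measurable_fun setT (fun w => expR (`|f w| / k)).
  apply: measurableT_comp => //; apply: measurable_funM => //.
  exact: measurableT_comp.
have c1 : C^-1 <= 1 by rewrite invf_le1.
exists (fun w => (1 - C^-1) + C^-1 * expR (`|f w| / k)).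
  by apply: measurable_funD => //; apply: measurable_funM.
split=> [w|].
  have [C2|Cn1] := eqVneq C 1; first by rewrite C2 invr1 subrr add0r !mul1r.
  have Cgt1 : 0 < C - 1 by rewrite subr_gt0 lt_neqAle eq_sym Cn1.
  have := @expR_weighted (C - 1) 1 0 (`|f w| / k) Cgt1 ltr01.
  rewrite add0r subrK mul0r expR0 mulr1 divr1 mul1r.
  have -> : (C - 1) / C = 1 - C^-1 by field; rewrite gt_eqF.
  have -> : `|f w| / (C * k) = `|f w| / k / C.
    by rewrite invfM mulrA mulrAC.
  exact.
have -> : (fun w => ((1 - C^-1) + C^-1 * expR (`|f w| / k))%:E) =
    (fun w => ((1 - C^-1) * cst 1 w + C^-1 * expR (`|f w| / k))%:E).
  by apply/funext => w; rewrite /cst mulr1.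
rewrite ge0_integral_lincomb ?subr_ge0 ?invr_ge0 ?(ltW C0) //.
rewrite /cst integral_cst //= probability_setT !mule1.
apply: (@le_trans _ _ ((1 - C^-1)%:E + (C^-1)%:E * C%:E)%E).
  by apply: leeD => //; rewrite lee_pmul2l // lte_fin invr_gt0.
rewrite -EFinM -EFinD lee_fin mulVf ?gt_eqF //.
by rewrite -[leRHS]/(1 + 1) lerD2r gerBl invr_ge0 ltW.
Qed.

(** [exp |x|] is at most [exp x + exp (- x)]. *)
Lemma orlicz_mgf f k C : 0 < k -> 1 <= C -> measurable_fun setT f ->
  (\int[P]_w (expR (k^-1 * f w))%:E <= C%:E)%E ->
  (\int[P]_w (expR (- k^-1 * f w))%:E <= C%:E)%E -> orlicz f ((C + C) * k).
Proof.
move=> k0 C1 mf f1 f2; apply: orlicz_intro => //; first by lra.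
have m1 a : measurable_fun setT (fun w => (expR (a * f w))%:E).
  by apply/measurable_EFinP; apply: measurableT_comp => //; apply: measurable_funM.
apply: (@le_trans _ _ (\int[P]_w ((expR (k^-1 * f w))%:E + (expR (- k^-1 * f w))%:E))%E).
  apply: le_ge0_integral => w; first by rewrite lee_fin expR_ge0.
  rewrite -EFinD lee_fin mulNr mulrC.
  have [f0|f0] := leP 0 (f w).
    by rewrite ger0_norm // lerDl expR_ge0.
  by rewrite ltr0_norm // mulrN lerDr expR_ge0.
by rewrite ge0_integralD // EFinD leeD.
Qed.

End OrliczNorm.

(** [x ^ r <= (1 + n!) exp x] for any integer [n >= r], so the moment of order [r] is
    at most a constant times [k ^ r]. *)
Lemma orlicz_Lr (R : realType) (r : R) : 1 <= r -> exists2 c : R, 0 < c &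
  forall (dT : measure_display) (T : measurableType dT) (P : probability T R)
    (f : T -> R) (k : R),
  0 < k -> orlicz P f k -> (Lr_norm P r f <= (c * k)%:E)%E.
Proof.
move=> r1; have r0 : 0 < r by exact: lt_le_trans r1.
pose n := (Num.trunc r).+1.
have rn : r <= n%:R by apply: ltW; rewrite /n truncnS_gt.
have n0 : (0 : R) < n`!%:R by rewrite ltr0n fact_gt0.
pose M := (1 + n`!%:R) * 2 : R.
have M0 : 0 < M by rewrite mulr_gt0 // addr_gt0.
exists (M `^ r^-1) => [|dT T P f k k0 [g mg [fg g2]]]; first exact: powR_gt0.
have g0 w : 0 <= g w by apply: le_trans (fg w); apply: expR_ge0.
rewrite /Lr_norm.
have E0 : (0 <= 'E_P[fun w => (`|f w| `^ r)%R])%E.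
  by rewrite unlock; apply: integral_ge0 => w _; rewrite lee_fin powR_ge0.
have key x : 0 <= x -> x `^ r <= (1 + n`!%:R) * expR x.
  move=> x0; rewrite mulrDl mul1r.
  have [x1|x1] := leP x 1.
    rewrite -[leLHS]addr0 lerD ?mulr_ge0 ?expR_ge0 ?(ltW n0) //.
    apply: le_trans (_ : 1 <= _); last by rewrite -expR0 ler_expR.
    have -> : 1 = (1 : R) `^ r by rewrite powR1.
    by rewrite ge0_ler_powR ?nnegrE // ltW.
  rewrite -[leLHS]add0r lerD ?expR_ge0 //.
  apply: (@le_trans _ _ (x `^ n%:R)); first by rewrite ler_powR // ltW.
  rewrite powR_mulrn // mulrC -ler_pdivrMr //.
  apply: le_trans (expR_ge1Dxn n.-1 x0); rewrite /n /=; lra.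
have EM : ('E_P[fun w => (`|f w| `^ r)%R] <= (k `^ r * M)%:E)%E.
  rewrite unlock.
  apply: (@le_trans _ _ (\int[P]_w ((k `^ r * (1 + n`!%:R))%:E * (g w)%:E)))%E.
    apply: le_ge0_integral => w; first by rewrite lee_fin powR_ge0.
    rewrite -EFinM lee_fin.
    have -> : `|f w| = k * (`|f w| / k) by rewrite mulrC divfK // gt_eqF.
    rewrite powRM ?divr_ge0 ?(ltW k0) // -mulrA ler_wpM2l ?powR_ge0 //.
    apply: le_trans (key _ _) _; first by rewrite divr_ge0 // ltW.
    by rewrite ler_pM2l // addr_gt0.
  rewrite ge0_integralZl_EFin //; last 3 first.
  - by move=> w _; rewrite lee_fin.
  - by apply/measurable_EFinP.
  - by rewrite mulr_ge0 ?powR_ge0 // addr_ge0 // ltW.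
  rewrite /M mulrA [leRHS]EFinM lee_wpmul2l // lee_fin.
  by rewrite mulr_ge0 ?powR_ge0 // addr_ge0 // ltW.
apply: le_trans (gt0_ler_poweR _ _ _ EM) _.
- by rewrite invr_ge0 ltW.
- by rewrite in_itv /= leey E0.
- by rewrite in_itv /= leey lee_fin mulr_ge0 ?powR_ge0 // ltW.
rewrite poweR_EFin lee_fin powRM ?powR_ge0 ?(ltW M0) //.
by rewrite -powRrM divff ?gt_eqF // powRr1 ?(ltW k0) // mulrC.
Qed.

(** * Mutual independence and Gaussian samples *)

Section MutualIndependence.
Context {dT : measure_display} {T : measurableType dT} {R : realType}.
Variable P : probability T R.
Variables (I : Type) (F : I -> set_system T).
Hypotheses (F_meas : forall i, F i `<=` measurable) (F_setT : forall i, F i setT)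
  (F_setI : forall i, setI_closed (F i)) (F_indep : mutually_independent P F).

Local Notation cI := {classic I}.

Definition cylinder (l : seq cI) (A : I -> set T) : set T :=
  [set w | forall j : I, (j : cI) \in l -> A j w].

(** Generates the sigma-algebra of all members of [F] but the [i]-th; being a
    pi-system, it suits the product rule of [indep_of]. *)
Definition others (i : I) : set_system T :=
  [set E | exists (l : seq cI) (A : I -> set T),
     [/\ (i : cI) \notin l, forall j, F j (A j) & E = cylinder l A]].

Lemma cylinder_cons j l A : cylinder (j :: l) A = A j `&` cylinder l A.
Proof.
apply/seteqP; split=> [w lA|w [jA lA] k].
  by split=> [|k kl]; apply: lA; rewrite inE ?eqxx // kl orbT.
by rewrite inE => /orP[/eqP ->//|/lA].
Qed.

Lemma cylinder_nil A : cylinder [::] A = setT.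
Proof. by apply/seteqP; split. Qed.

Lemma measurable_cylinder l A : (forall j, F j (A j)) -> measurable (cylinder l A).
Proof.
move=> FA; elim: l => [|j l IH]; first by rewrite cylinder_nil.
by rewrite cylinder_cons; apply: measurableI => //; apply: F_meas (FA j).
Qed.

Lemma probability_cylinder (l : seq cI) A : uniq l -> (forall j, F j (A j)) ->
  P (cylinder l A) = (\prod_(j <- l) P (A j))%E.
Proof.
move=> ul FA; rewrite big_tnth /=.
have fi : injective (tnth (in_tuple l)) by apply/tuple_uniqP.
rewrite -(F_indep (E := fun j => A (tnth (in_tuple l) j)) fi) //.
congr (P _); apply/seteqP; split=> w /= lA.
  by move=> j _; apply: lA; rewrite mem_tnth.
by move=> j /(tnthP (in_tuple l))[k ->]; apply: lA.
Qed.

Lemma others_setI i : setI_closed (others i).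
Proof.
move=> _ _ [l1 [A1 [il1 FA1 ->]]] [l2 [A2 [il2 FA2 ->]]].
pose A (j : I) := (if (j : cI) \in l1 then A1 j else setT) `&`
  (if (j : cI) \in l2 then A2 j else setT).
exists (l1 ++ l2), A; split.
- by rewrite mem_cat negb_or il1.
- by move=> j; apply: F_setI; case: ifP.
- apply/seteqP; split=> w /=.
    by move=> [h1 h2] j _; split; case: ifP => //; [apply: h1|apply: h2].
  by move=> h; split=> j jl; have := h j; rewrite mem_cat jl ?orbT => /(_ isT)[];
    rewrite jl.
Qed.

(** An event of [F i] completes a cylinder over the other indices to a cylinder with
    one more factor. *)
Lemma indep_others i (h : T -> R) :
  (forall B, measurable B -> F i (h @^-1` B)) -> indep_of P (others i) h.
Proof.
move=> Fh; split.
- exact: others_setI.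
- by exists [::], (fun=> setT); split=> //; rewrite cylinder_nil.
- by move=> _ [l [A [_ FA ->]]]; apply: measurable_cylinder.
- by move=> _ B mB; rewrite setTI; apply: F_meas (Fh B mB).
- move=> _ B [l [A [il FA ->]]] mB.
  pose A' (j : I) := if (j : cI) == i then h @^-1` B else A j.
  have FA' j : F j (A' j) by rewrite /A'; case: eqP => [->|//]; apply: Fh.
  have ul := undup_uniq l.
  have cyl (D : I -> set T) : cylinder l D = cylinder (undup l) D.
    by apply/seteqP; split=> w lD j jl; apply: lD; rewrite mem_undup in jl *.
  have A'i : A' i = h @^-1` B by rewrite /A' eqxx.
  have AA' : cylinder (undup l) A = cylinder (undup l) A'.
    apply/seteqP; split=> w lD j jl; have := lD j jl; rewrite /A'; case: eqP => // ji;
    by move: il; rewrite -ji -mem_undup jl.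
  rewrite cyl AA' -A'i setIC -cylinder_cons !probability_cylinder //=.
    by rewrite big_cons muleC.
  by rewrite mem_undup il.
Qed.

Lemma others_sub i j (E : set T) : i <> j -> F j E -> others i E.
Proof.
move=> ij FE; pose A (k : I) := if (k : cI) == j then E else setT.
exists [:: (j : cI)], A; split.
- by rewrite inE; apply/eqP.
- by move=> k; rewrite /A; case: eqP => [->|].
- by rewrite cylinder_cons cylinder_nil setIT /A eqxx.
Qed.

Lemma measurable_fun_others i j (f : T -> R) : i <> j ->
  (forall B, measurable B -> F j (f @^-1` B)) ->
  measurable_fun setT (f : g_sigma_algebraType (others i) -> R).
Proof.
move=> ij Ff _ B mB; rewrite setTI; apply: sub_sigma_algebra.
exact: others_sub (Ff B mB).
Qed.

End MutualIndependence.

Section RandomVectors.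
Context {dT : measure_display} {T : measurableType dT} {R : realType}.
Variable P : probability T R.

Lemma borel_coord n (i : 'I_n) (B : set R) : measurable B ->
  borel_cV ((fun x : 'cV[R]_n => x i 0) @^-1` B).
Proof.
pose VT : measurableType _ := g_sigma_algebraType [set C : set 'cV[R]_n | open C].
have mc : measurable_fun setT ((fun x => x i 0) : VT -> R).
  apply: (measurability _ (RGenOpens.measurableE R)).
  move=> _ [_ [a [b ->]] <-]; rewrite setTI; apply: sub_sigma_algebra => /=.
  apply: open_comp; last exact: interval_open.
  by move=> x _; apply: coord_continuous.
by move=> mB; have := mc measurableT B mB; rewrite setTI.
Qed.

Lemma borel_linear n (u : 'cV[R]_n) (B : set R) : measurable B ->
  borel_cV ((fun x : 'cV[R]_n => (u^T *m x) 0 0) @^-1` B).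
Proof.
pose VT : measurableType _ := g_sigma_algebraType [set C : set 'cV[R]_n | open C].
have mc : measurable_fun setT ((fun x => (u^T *m x) 0 0) : VT -> R).
  have -> : (fun x => (u^T *m x) 0 0) = (fun x : 'cV[R]_n => \sum_i u i 0 * x i 0).
    by apply/funext => x; rewrite mxE; apply: eq_bigr => i _; rewrite mxE.
  apply: (@measurable_sum _ VT) => i; apply: measurable_funM => //.
  by move=> _ C mC; rewrite setTI; apply: borel_coord.
by move=> mB; have := mc measurableT B mB; rewrite setTI.
Qed.

Lemma sigma_of_linear n (X : T -> 'cV[R]_n) (u : 'cV[R]_n) (B : set R) : measurable B ->
  sigma_of X ((fun w => (u^T *m X w) 0 0) @^-1` B).
Proof.
by move=> /(borel_linear u) mB; exists ((fun x => (u^T *m x) 0 0) @^-1` B).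
Qed.

Lemma sigma_of_setT n (X : T -> 'cV[R]_n) : sigma_of X setT.
Proof.
pose VT : measurableType _ := g_sigma_algebraType [set C : set 'cV[R]_n | open C].
by exists setT => //; exact: (@measurableT _ VT).
Qed.

Lemma sigma_of_setI n (X : T -> 'cV[R]_n) : setI_closed (sigma_of X).
Proof.
pose VT : measurableType _ := g_sigma_algebraType [set C : set 'cV[R]_n | open C].
move=> _ _ [A mA <-] [B mB <-]; exists (A `&` B); last by rewrite preimage_setI.
exact: (@measurableI _ VT).
Qed.

End RandomVectors.

Section IndependentGaussians.
Context {dT : measure_display} {T : measurableType dT} {R : realType}.
Variable P : probability T R.

(** A sample [h] of independent Gaussian variables, together with for each [i] a
    pi-system [G i] of events independent of [h i] that sees the other variables. *)
Record gaussian_sample n (G : 'I_n -> set_system T) (h : 'I_n -> T -> R)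
    (m s : R) : Prop := {
  gs_sd : 0 < s ;
  gs_indep : forall i, indep_of P (G i) (h i) ;
  gs_law : forall i B, measurable B -> P (h i @^-1` B) = normal_prob m s B ;
  gs_cross : forall i j, i != j ->
    measurable_fun setT (h j : g_sigma_algebraType (G i) -> R) }.

Section Sample.
Variables (n : nat) (G : 'I_n -> set_system T) (h : 'I_n -> T -> R) (m s : R).
Hypothesis hG : gaussian_sample G h m s.

Local Notation GT i := (g_sigma_algebraType (G i)).

Lemma gs_measurable i : measurable_fun setT (h i).
Proof. exact: indep_mfun (gs_indep hG i). Qed.

(** The variables are integrated out one at a time, the weights and the remaining
    variables being frozen: in [mix k] the first [k] factors have already been
    replaced. *)
Lemma gaussian_sample_mgf a (t : 'I_n -> T -> R) : 0 < 1 - 2 * a * s ^+ 2 ->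
  (forall i j, measurable_fun setT (t i : GT j -> R)) ->
  (\int[P]_w (\prod_i expR (a * (h i w - m) ^+ 2 + t i w * (h i w - m)))%:E =
   \int[P]_w (\prod_i (expR (t i w ^+ 2 * s ^+ 2 / (2 * (1 - 2 * a * s ^+ 2))) /
     Num.sqrt (1 - 2 * a * s ^+ 2)))%:E)%E.
Proof.
move=> w0 mt; have s0 := gs_sd hG.
pose phi i w := expR (a * (h i w - m) ^+ 2 + t i w * (h i w - m)).
pose psi i w := expR (t i w ^+ 2 * s ^+ 2 / (2 * (1 - 2 * a * s ^+ 2))) /
     Num.sqrt (1 - 2 * a * s ^+ 2).
pose mix k (i : 'I_n) w := if (i < k)%N then psi i w else phi i w.
suff main k : (k <= n)%N ->
    (\int[P]_w (\prod_i phi i w)%:E = \int[P]_w (\prod_(i < n) mix k i w)%:E)%E.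
  rewrite (main n) //; apply: eq_integral => w _; congr (_%:E).
  by apply: eq_bigr => i _; rewrite /mix ltn_ord.
elim: k => [_|k IH kn]; first by apply: eq_integral.
rewrite IH ?(ltnW kn) //; pose io := Ordinal kn.
pose rest w := \prod_(i < n | i != io) mix k i w.
transitivity (\int[P]_w (rest w * phi io w)%:E)%E.
  apply: eq_integral => w _; congr (_%:E).
  by rewrite (bigD1 io) //= mulrC /mix ltnn.
transitivity (\int[P]_w (rest w * psi io w)%:E)%E; last first.
  apply: eq_integral => w _; congr (_%:E).
  rewrite (bigD1 io) //= mulrC /mix ltnSn; congr (_ * _).
  apply: eq_bigr => i; rewrite -val_eqE /= => ik.
  by rewrite ltnS [in RHS]leq_eqVlt (negbTE ik).
apply: (gaussian_freezing (gs_indep hG io) (gs_law hG io)) => //.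
  rewrite /rest; under eq_fun do rewrite -big_filter.
  apply: (@measurable_prod _ (GT io)) => i; rewrite mem_filter => /andP[iio _].
  have mh : measurable_fun setT (h i : GT io -> R) by apply: (gs_cross hG); rewrite eq_sym.
  have -> : mix k i = if (i < k)%N then psi i else phi i.
    by apply/funext => w; rewrite /mix; case: ifP.
  case: ifP => _.
    apply: measurable_funM => //; apply: measurableT_comp => //.
    apply: measurable_funM => //; apply: measurable_funM => //.
    exact: measurable_funX.
  have mhm : measurable_fun setT ((fun w => h i w - m) : GT io -> R).
    exact: measurable_funB.
  apply: measurableT_comp => //; apply: measurable_funD.
    by apply: measurable_funM => //; apply: measurable_funX.
  exact: measurable_funM.
move=> w; apply: prodr_ge0 => i _; rewrite /mix; case: ifP => _ //.
  by rewrite divr_ge0 ?expR_ge0 ?sqrtr_ge0.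
exact: expR_ge0.
Qed.

Lemma gaussian_sample_mgf_square a : 0 < 1 - 2 * a * s ^+ 2 ->
  (\int[P]_w (expR (a * \sum_i (h i w - m) ^+ 2))%:E =
   (((Num.sqrt (1 - 2 * a * s ^+ 2))^-1) ^+ n)%:E)%E.
Proof.
move=> w0; have := @gaussian_sample_mgf a (fun _ _ => 0) w0.
move=> /(_ (fun i j => @measurable_cst _ _ (GT j) R setT 0)) E.
transitivity (\int[P]_w (\prod_i expR (a * (h i w - m) ^+ 2 + 0 * (h i w - m)))%:E)%E.
  apply: eq_integral => w _; congr (_%:E); rewrite mulr_sumr expR_sum.
  by apply: eq_bigr => i _; rewrite mul0r addr0.
rewrite E expr2 !mul0r expR0 mul1r prodr_const card_ord.
by rewrite integral_cst //= probability_setT mule1.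
Qed.

Lemma gaussian_sample_mgf_linear (t : 'I_n -> T -> R) :
  (forall i j, measurable_fun setT (t i : GT j -> R)) ->
  (\int[P]_w (expR (\sum_i t i w * (h i w - m)))%:E =
   \int[P]_w (expR (s ^+ 2 / 2 * \sum_i t i w ^+ 2))%:E)%E.
Proof.
move=> mt; have w1 : 1 - 2 * 0 * s ^+ 2 = 1 by rewrite mulr0 mul0r subr0.
have := @gaussian_sample_mgf 0 t; rewrite w1 => /(_ ltr01 mt) E.
transitivity (\int[P]_w (\prod_i expR (0 * (h i w - m) ^+ 2 + t i w * (h i w - m)))%:E)%E.
  apply: eq_integral => w _; congr (_%:E); rewrite expR_sum.
  by apply: eq_bigr => i _; rewrite mul0r add0r.
rewrite E; apply: eq_integral => w _; congr (_%:E); rewrite mulr_sumr expR_sum.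
apply: eq_bigr => i _; rewrite sqrtr1 divr1 mulr1; congr expR.
by field.
Qed.

(** Integrating out the last variable leaves the square of a shorter sum, with [a]
    replaced by [a' = a / (1 - 2 a s^2)], that is [1 / a' = 1 / a - 2 s^2]. *)
Lemma gaussian_partial_sum_mgf_square k a : (k <= n)%N -> 0 <= a ->
  0 < 1 - 2 * a * s ^+ 2 * k%:R ->
  (\int[P]_w (expR (a * (\sum_(i < n | (i < k)%N) (h i w - m)) ^+ 2))%:E =
   ((Num.sqrt (1 - 2 * a * s ^+ 2 * k%:R))^-1)%:E)%E.
Proof.
have s0 := gs_sd hG; have s20 : 0 <= s ^+ 2 by apply: sqr_ge0.
elim: k a => [|k IH] a kn a0 w0.
  transitivity (\int[P]_w (cst 1%:E w))%E.
    by apply: eq_integral => w _; rewrite big1 // expr0n mulr0 expR0.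
  by rewrite integral_cst //= probability_setT mule1 mulr0 subr0 sqrtr1 invr1.
pose io := Ordinal kn.
pose S w := \sum_(i < n | (i < k)%N) (h i w - m).
have w1 : 0 < 1 - 2 * a * s ^+ 2.
  apply: lt_le_trans w0 _; rewrite lerD2l lerN2 ler_peMr ?mulr_ge0 ?ler1n //; exact: ltW.
pose a' := a / (1 - 2 * a * s ^+ 2).
transitivity (\int[P]_w (expR (a * S w ^+ 2) *
    expR (a * (h io w - m) ^+ 2 + 2 * a * S w * (h io w - m)))%:E)%E.
  apply: eq_integral => w _; congr (_%:E).
  rewrite (bigD1 io) //= -expRD; congr expR.
  have -> : \sum_(i < n | (i < k.+1)%N && (i != io)) (h i w - m) = S w.
    apply: eq_bigl => i; rewrite ltnS [RHS]ltn_neqAle andbC.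
    by rewrite -val_eqE.
  by ring.
have mS : measurable_fun setT (S : GT io -> R).
  have -> : S = fun w => \sum_(i < n) (if (i < k)%N then fun w => h i w - m else cst 0) w.
    by apply/funext => w; rewrite /S big_mkcond; apply: eq_bigr => i _; case: ifP.
  apply: (@measurable_sum _ (GT io)) => i; case: ifP => // ik.
  apply: measurable_funB => //; apply: (gs_cross hG).
  by rewrite -val_eqE /= gtn_eqF.
rewrite (gaussian_freezing (gs_indep hG io) (gs_law hG io) s0 w1); first last.
- by move=> w; apply: expR_ge0.
- by apply: measurable_funM.
- by apply: measurableT_comp => //; apply: measurable_funM => //; apply: measurable_funX.
have a'0 : 0 <= a' by rewrite divr_ge0 // ltW.
have a'w : 0 < 1 - 2 * a' * s ^+ 2 * k%:R.
  have -> : 1 - 2 * a' * s ^+ 2 * k%:R =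
     (1 - 2 * a * s ^+ 2 * k.+1%:R) / (1 - 2 * a * s ^+ 2).
    by rewrite /a' -natr1; field; rewrite gt_eqF.
  exact: divr_gt0.
transitivity (\int[P]_w (((Num.sqrt (1 - 2 * a * s ^+ 2))^-1)%:E *
   (expR (a' * S w ^+ 2))%:E))%E.
  apply: eq_integral => w _; rewrite -EFinM; congr (_%:E).
  rewrite mulrA -expRD mulrC; congr (_ * expR _).
  by rewrite /a'; field; rewrite gt_eqF.
rewrite ge0_integralZl_EFin //; first last.
  apply/measurable_EFinP; apply: measurableT_comp => //; apply: measurable_funM => //.
  apply: measurable_funX; exact: (measurable_fun_sub (gs_indep hG io) mS).
rewrite IH ?(ltnW kn) // -EFinM -invfM -sqrtrM ?(ltW w1) //.
congr ((Num.sqrt _)^-1)%:E; rewrite /a' -natr1; field.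
by rewrite gt_eqF.
Qed.

End Sample.
End IndependentGaussians.

(** * Concentration of empirical moments of Gaussian samples *)

Section Concentration.
Context {dT : measure_display} {T : measurableType dT} {R : realType}.
Variable P : probability T R.
Variables (N : nat) (G : 'I_N.+1 -> set_system T) (h : 'I_N.+1 -> T -> R) (m s : R).
Hypotheses (hG : gaussian_sample P G h m s).

Local Notation GT i := (g_sigma_algebraType (G i)).
Variable rN : R.
Hypotheses (rN1 : 1 <= rN) (rNE : rN ^+ 2 = N%:R).

Let rN0 : 0 < rN. Proof. exact: lt_le_trans rN1. Qed.
Let NR0 : 0 < N%:R :> R. Proof. by rewrite -rNE exprn_gt0. Qed.

Let NS : N.+1%:R = N%:R + 1 :> R. Proof. by rewrite natr1. Qed.

(** After squaring, [exp y >= 1 + y] suffices, since [(1 - x) (1 + x + 2 x^2) >= 1] for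
    [x <= 1 / 2]. *)
Lemma sqrtr_onem_inv_le (x : R) : `|x| <= 2^-1 ->
  (Num.sqrt (1 - x))^-1 <= expR (x / 2 + x ^+ 2).
Proof.
rewrite ler_norml => /andP[x1 x2].
have x0 : 0 < 1 - x by lra.
have y0 : 0 <= expR (x / 2 + x ^+ 2) by apply: expR_ge0.
rewrite -[leLHS]mul1r ler_pdivrMr ?sqrtr_gt0 // -(@ler_pXn2r _ 2) ?nnegrE ?mulr_ge0 ?sqrtr_ge0 //.
rewrite expr1n exprMn sqr_sqrtr ?(ltW x0) // -expRM_natr.
have := expR_ge1Dx ((x / 2 + x ^+ 2) * 2%:R); nra.
Qed.

(** In the Laplace transform, centring cancels the terms of first order, and the
    [N + 1] terms of second order, each of size [1 / N], have a bounded sum. *)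
Lemma orlicz_centered_squares :
  orlicz P (fun w => N%:R^-1 * \sum_i ((h i w - m) ^+ 2 - s ^+ 2))
    (8 * expR 1 * s ^+ 2 / rN).
Proof.
have s0 := gs_sd hG; have s20 : 0 < s ^+ 2 by rewrite exprn_gt0.
have e1 : 1 <= expR 1 :> R by rewrite -expR0 ler_expR.
(* At this scale [a * s ^+ 2 = b / (4 * rN)], within the reach of [sqrtr_onem_inv_le]. *)
pose k := 4 * s ^+ 2 / rN.
have k0 : 0 < k by rewrite divr_gt0 // mulr_gt0.
have -> : 8 * expR 1 * s ^+ 2 / rN = (expR 1 + expR 1) * k.
  by rewrite /k; field; rewrite gt_eqF.
have bound b : b ^+ 2 = 1 ->
    (\int[P]_w (expR (b * k^-1 * (N%:R^-1 * \sum_i ((h i w - m) ^+ 2 - s ^+ 2))))%:E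
     <= (expR 1)%:E)%E.
  move=> b1; pose a := b * k^-1 * N%:R^-1.
  have aE : a * s ^+ 2 = b / (4 * rN).
    by rewrite /a /k -rNE; field; rewrite !gt_eqF.
  have b2 : `|b| = 1 by apply/eqP; rewrite -sqrp_eq1 // real_normK ?num_real // b1.
  have a2 : `|2 * a * s ^+ 2| <= 2^-1.
    rewrite -mulrA aE normrM normrM b2 mul1r normfV !ger0_norm //; last first.
      by rewrite mulr_ge0 // ltW.
    rewrite ler_pdivrMr ?mulr_gt0 //; move: rN1; lra.
  have w0 : 0 < 1 - 2 * a * s ^+ 2.
    by move: a2; rewrite ler_norml => /andP[]; lra.
  have mq : measurable_fun setT (fun w => (expR (a * \sum_i (h i w - m) ^+ 2))%:E).
    apply/measurable_EFinP; apply: measurableT_comp => //; apply: measurable_funM => //.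
    apply: measurable_sum => i; apply: measurable_funX; apply: measurable_funB => //.
    exact: (gs_measurable hG).
  have -> : (\int[P]_w (expR (b * k^-1 * (N%:R^-1 * \sum_i ((h i w - m) ^+ 2 - s ^+ 2))))%:E =
     \int[P]_w ((expR (- (a * s ^+ 2) * N.+1%:R))%:E *
      (expR (a * \sum_i (h i w - m) ^+ 2))%:E))%E.
    apply: eq_integral => w _; rewrite -EFinM -expRD; congr (expR _)%:E.
    rewrite sumrB sumr_const card_ord -[s ^+ 2 *+ _]mulr_natr mulrA -/a; ring.
  rewrite ge0_integralZl_EFin //; try by move=> w _; rewrite lee_fin expR_ge0.
  rewrite (gaussian_sample_mgf_square hG) // -EFinM lee_fin.
  apply: (@le_trans _ _ (expR (- (a * s ^+ 2) * N.+1%:R) *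
      expR (2 * a * s ^+ 2 / 2 + (2 * a * s ^+ 2) ^+ 2) ^+ N.+1)).
    rewrite ler_wpM2l ?expR_ge0 // lerXn2r ?nnegrE ?expR_ge0 ?invr_ge0 ?sqrtr_ge0 //.
    exact: sqrtr_onem_inv_le.
  rewrite -expRM_natr -expRD ler_expR.
  have -> : - (a * s ^+ 2) * N.+1%:R +
      (2 * a * s ^+ 2 / 2 + (2 * a * s ^+ 2) ^+ 2) * N.+1%:R =
      4 * (a * s ^+ 2) ^+ 2 * N.+1%:R by field.
  have -> : 4 * (a * s ^+ 2) ^+ 2 * N.+1%:R = b ^+ 2 * (4^-1 + 4^-1 * N%:R^-1).
    by rewrite aE NS -rNE; field; rewrite gt_eqF.
  rewrite b1 mul1r.
  have : N%:R^-1 <= 1 :> R by rewrite invf_le1 // -rNE exprn_ege1.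
  lra.
have mf : measurable_fun setT (fun w => N%:R^-1 * \sum_i ((h i w - m) ^+ 2 - s ^+ 2)).
  apply: measurable_funM => //; apply: measurable_sum => i; apply: measurable_funB => //.
  by apply: measurable_funX; apply: measurable_funB => //; exact: (gs_measurable hG).
apply: (orlicz_mgf k0 e1 mf).
  by have := bound 1; rewrite expr1n mul1r; apply.
by have := bound (-1); rewrite sqrrN expr1n mulN1r; apply.
Qed.

Lemma orlicz_cst (v : R) : 0 < v -> orlicz P (cst v) (expR 1 * v).
Proof.
move=> v0; apply: orlicz_intro => //; first by rewrite -expR0 ler_expR.
under eq_integral do rewrite /cst gtr0_norm // divff ?gt_eqF //.
by rewrite integral_cst //= probability_setT mule1.
Qed.

(** The variable is [s^2 / N] times the square of a standard Gaussian, thus even of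
    order [1 / N]. *)
Lemma orlicz_mean_square :
  orlicz P (fun w => (N%:R * N.+1%:R)^-1 * (\sum_i (h i w - m)) ^+ 2)
    (8 * s ^+ 2 / rN).
Proof.
have s0 := gs_sd hG; have s20 : 0 < s ^+ 2 by rewrite exprn_gt0.
have NS0 : 0 < N.+1%:R :> R by rewrite ltr0n.
pose k := 4 * s ^+ 2 / N%:R.
have k0 : 0 < k by rewrite divr_gt0 // mulr_gt0.
have k2 : 2 * k <= 8 * s ^+ 2 / rN.
  have -> : 8 * s ^+ 2 / rN = 2 * (4 * s ^+ 2 / rN) by field; rewrite gt_eqF.
  rewrite ler_pM2l // /k ler_pM2l ?mulr_gt0 // lef_pV2 ?posrE // -rNE.
  by rewrite expr2 ler_peMl // ltW.
apply: (orlicz_mono _ k2); first by rewrite mulr_gt0.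
have mS : measurable_fun setT (fun w => \sum_i (h i w - m)).
  apply: measurable_sum => i; apply: measurable_funB => //; exact: (gs_measurable hG).
apply: orlicz_intro => //; first by rewrite ler1n.
  by apply: measurable_funM => //; apply: measurable_funX.
(* With this choice, the square root in the Laplace transform is that of one half. *)
pose a := (4 * s ^+ 2 * N.+1%:R)^-1.
have a0 : 0 <= a by rewrite invr_ge0 !mulr_ge0 ?ltW.
have aw : 1 - 2 * a * s ^+ 2 * N.+1%:R = 2^-1.
  by rewrite /a; field; rewrite !gt_eqF.
have w0 : 0 < 1 - 2 * a * s ^+ 2 * N.+1%:R by rewrite aw invr_gt0.
apply: (@le_trans _ _ ((Num.sqrt (1 - 2 * a * s ^+ 2 * N.+1%:R))^-1)%:E).
  rewrite -(gaussian_partial_sum_mgf_square hG (leqnn _) a0 w0).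
  apply: le_ge0_integral => w; first by rewrite lee_fin expR_ge0.
  have -> : \sum_(i < N.+1 | (i < N.+1)%N) (h i w - m) = \sum_i (h i w - m).
    by apply: eq_bigl => i; rewrite ltn_ord.
  rewrite lee_fin ler_expR.
  rewrite ger0_norm; last first.
    by rewrite mulr_ge0 ?sqr_ge0 // invr_ge0 mulr_ge0 // ltW.
  rewrite le_eqVlt; apply/orP; left; apply/eqP.
  by rewrite /k /a; field; rewrite !gt_eqF.
rewrite aw lee_fin -sqrtrV ?invr_ge0 // invrK.
by rewrite -(@ler_pXn2r _ 2) ?nnegrE ?sqrtr_ge0 // sqr_sqrtr //; lra.
Qed.

(** The sum of the squared deviations is the sum of the centred squares minus the
    square of the centred sum; a term [s^2 / N] remains because [N + 1] squares are
    divided by [N]. *)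
Lemma orlicz_sample_variance :
  orlicz P (fun w => N%:R^-1 * \sum_i (h i w - N.+1%:R^-1 * \sum_j h j w) ^+ 2 - s ^+ 2)
    ((9 * expR 1 + 8) * s ^+ 2 / rN).
Proof.
have s0 := gs_sd hG; have s20 : 0 < s ^+ 2 by rewrite exprn_gt0.
have NS0 : 0 < N.+1%:R :> R by rewrite ltr0n.
have e0 : 0 < expR 1 :> R by apply: expR_gt0.
have c0 : 0 < expR 1 * (s ^+ 2 / N%:R) by rewrite mulr_gt0 // divr_gt0.
have c1 : 0 < 8 * expR 1 * s ^+ 2 / rN by rewrite divr_gt0 // !mulr_gt0.
have c2 : 0 < 8 * s ^+ 2 / rN by rewrite divr_gt0 // !mulr_gt0.
have O1 := orliczD c2 c0 orlicz_mean_square (orlicz_cst (divr_gt0 s20 NR0)).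
have {O1} := orliczD c1 (addr_gt0 c2 c0) orlicz_centered_squares O1.
set c := _ + _ => O1; have cpos : 0 < c by rewrite /c !addr_gt0.
apply: (@orlicz_mono _ _ _ _ _ c) => //.
  rewrite /c.
  have -> : (9 * expR 1 + 8) * s ^+ 2 / rN = 8 * expR 1 * s ^+ 2 / rN +
     (8 * s ^+ 2 / rN + expR 1 * (s ^+ 2 / rN)) by field; rewrite gt_eqF.
  rewrite !lerD2l ler_pM2l // ler_pM2l // lef_pV2 ?posrE // -rNE.
  by rewrite expr2 ler_peMl // ltW.
apply: orlicz_dom cpos O1 => w; rewrite /cst.
set D := \sum_i (_ - s ^+ 2); set M := \sum_i (h i w - m).
have -> : N%:R^-1 * \sum_i (h i w - N.+1%:R^-1 * \sum_j h j w) ^+ 2 - s ^+ 2 =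
    N%:R^-1 * D + s ^+ 2 / N%:R - (N%:R * N.+1%:R)^-1 * M ^+ 2.
  have -> : \sum_i (h i w - N.+1%:R^-1 * \sum_j h j w) ^+ 2 =
      \sum_i (h i w - m) ^+ 2 - N.+1%:R^-1 * M ^+ 2.
    have hm i : h i w - N.+1%:R^-1 * \sum_j h j w = (h i w - m) - N.+1%:R^-1 * M.
      rewrite /M sumrB sumr_const card_ord -[m *+ _]mulr_natr; field.
      by rewrite gt_eqF.
    under eq_bigr do rewrite hm sqrrB.
    rewrite !big_split /= sumrN sumrMnl -mulr_suml -/M sumr_const card_ord.
    rewrite -[_ *+ N.+1]mulr_natr -[_ *+ 2]mulr_natr; field.
    by rewrite gt_eqF.
  rewrite /D sumrB sumr_const card_ord -[s ^+ 2 *+ _]mulr_natr NS; field.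
  by rewrite !gt_eqF // -NS.
set x := N%:R^-1 * D; set y := s ^+ 2 / N%:R; set z := _ * M ^+ 2.
rewrite [X in _ <= X]ger0_norm ?addr_ge0 // [X in _ <= _ + X]ger0_norm ?addr_ge0 //.
apply: le_trans (ler_normB _ _) _; rewrite addrCA [leRHS]addrC lerD2r.
exact: ler_normD.
Qed.

(** Conditionally on the weights [t], the sum is Gaussian with variance
    [s ^+ 2 * \sum_i t i ^+ 2]; exponential moments of the empirical second moment of
    the weights are thus all that is needed. *)
Lemma orlicz_weighted_sum (t : 'I_N.+1 -> T -> R) (theta C : R) :
  (forall i j, measurable_fun setT (t i : GT j -> R)) ->
  0 < theta -> 1 <= C ->
  (\int[P]_w (expR (theta * (N%:R^-1 * \sum_i t i w ^+ 2)))%:E <= C%:E)%E ->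
  orlicz P (fun w => N%:R^-1 * \sum_i t i w * (h i w - m))
    (2 * C * (s * (1 + theta^-1)) / rN).
Proof.
move=> mt th0 C1 tC; have s0 := gs_sd hG.
have thV : 0 < theta^-1 by rewrite invr_gt0.
(* Any scale with [k^2 N >= s^2 / (2 theta)] makes the conditional variance small
   enough; this one avoids a square root. *)
pose k := s * (1 + theta^-1) / rN.
have k0 : 0 < k by rewrite divr_gt0 // mulr_gt0 // addr_gt0.
have mtT i : measurable_fun setT (t i).
  exact: (measurable_fun_sub (gs_indep hG i) (mt i i)).
have bound b : b ^+ 2 = 1 -> (\int[P]_w (expR (b * k^-1 * (N%:R^-1 * \sum_i t i w * (h i w - m))))%:E
     <= C%:E)%E.
  move=> b1; pose a := b * k^-1 * N%:R^-1.
  have -> : (\int[P]_w (expR (b * k^-1 * (N%:R^-1 * \sum_i t i w * (h i w - m))))%:E =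
     \int[P]_w (expR (\sum_i (a * t i w) * (h i w - m)))%:E)%E.
    apply: eq_integral => w _; congr (expR _)%:E.
    by rewrite mulrA -/a mulr_sumr; apply: eq_bigr => i _; rewrite mulrA.
  rewrite (gaussian_sample_mgf_linear hG (t := fun i w => a * t i w)); last first.
    by move=> i j; apply: measurable_funM.
  apply: le_trans tC; apply: le_ge0_integral => w; first by rewrite lee_fin expR_ge0.
  rewrite lee_fin ler_expR.
  have -> : \sum_i (a * t i w) ^+ 2 = a ^+ 2 * \sum_i t i w ^+ 2.
    by rewrite mulr_sumr; apply: eq_bigr => i _; rewrite exprMn.
  rewrite mulrA [leRHS]mulrA.
  apply: ler_wpM2r; first by apply: sumr_ge0 => i _; apply: sqr_ge0.
  have -> : s ^+ 2 / 2 * a ^+ 2 = b ^+ 2 * ((2 * (1 + theta^-1) ^+ 2)^-1 / N%:R).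
    rewrite /a /k -rNE; field.
    by rewrite !gt_eqF // addr_gt0.
  rewrite b1 mul1r ler_wpM2r ?invr_ge0 ?(ltW NR0) //.
  rewrite -[leRHS]invrK lef_pV2 ?posrE //; last first.
    by rewrite mulr_gt0 // exprn_gt0 // addr_gt0.
  have := sqr_ge0 theta^-1; move: thV; nra.
have -> : 2 * C * (s * (1 + theta^-1)) / rN = (C + C) * k by rewrite /k; ring.
apply: (orlicz_mgf k0 C1).
- apply: measurable_funM => //; apply: measurable_sum => i; apply: measurable_funM => //.
  by apply: measurable_funB => //; exact: (gs_measurable hG).
- by have := bound 1; rewrite expr1n mul1r; apply.
- by have := bound (-1); rewrite sqrrN expr1n mulN1r; apply.
Qed.

End Concentration.

(** * Measurability of the filter *)

Section MatrixMeasurability.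
Context {dT : measure_display} {T : measurableType dT} {R : realType}.

Definition measurable_mx m n (M : T -> 'M[R]_(m, n)) : Prop :=
  forall i j, measurable_fun setT (fun w => M w i j).

Lemma measurable_fun_inv (f : T -> R) : measurable_fun setT f ->
  measurable_fun setT (fun w => (f w)^-1).
Proof.
move=> mf; have -> : (fun w => (f w)^-1) = fun w => f w * (f w ^+ 2) `^ (-1).
  (* Where [f w = 0], both sides vanish. *)
  apply/funext => w; have [->|f0] := eqVneq (f w) 0; first by rewrite invr0 mul0r.
  by rewrite powR_inv1 ?sqr_ge0 //; field.
apply: measurable_funM => //.
apply: (measurableT_comp (measurable_powR (-1))); exact: measurable_funX.
Qed.

Lemma measurable_mx_cst m n (M : 'M[R]_(m, n)) : measurable_mx (fun=> M).
Proof. by move=> i j; apply: measurable_cst. Qed.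

Lemma measurable_mxD m n (M1 M2 : T -> 'M[R]_(m, n)) :
  measurable_mx M1 -> measurable_mx M2 -> measurable_mx (fun w => M1 w + M2 w).
Proof.
move=> m1 m2 i j; under eq_fun do rewrite mxE; exact: measurable_funD.
Qed.

Lemma measurable_mxB m n (M1 M2 : T -> 'M[R]_(m, n)) :
  measurable_mx M1 -> measurable_mx M2 -> measurable_mx (fun w => M1 w - M2 w).
Proof.
move=> m1 m2 i j; under eq_fun do rewrite !mxE; exact: measurable_funB.
Qed.

Lemma measurable_mxZ m n a (M : T -> 'M[R]_(m, n)) :
  measurable_mx M -> measurable_mx (fun w => a *: M w).
Proof.
move=> mM i j; under eq_fun do rewrite mxE; exact: measurable_funM.
Qed.

Lemma measurable_mx_sum m n (I : Type) (s : seq I) (M : I -> T -> 'M[R]_(m, n)) :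
  (forall k, measurable_mx (M k)) -> measurable_mx (fun w => \sum_(k <- s) M k w).
Proof.
move=> mM i j; under eq_fun do rewrite summxE.
by apply: measurable_sum => k; apply: mM.
Qed.

Lemma measurable_mx_tr m n (M : T -> 'M[R]_(m, n)) :
  measurable_mx M -> measurable_mx (fun w => (M w)^T).
Proof. by move=> mM i j; under eq_fun do rewrite mxE; apply: mM. Qed.

Lemma measurable_mxM m n k (M1 : T -> 'M[R]_(m, n)) (M2 : T -> 'M[R]_(n, k)) :
  measurable_mx M1 -> measurable_mx M2 -> measurable_mx (fun w => M1 w *m M2 w).
Proof.
move=> m1 m2 i j; under eq_fun do rewrite mxE.
by apply: measurable_sum => l; apply: measurable_funM.
Qed.

Lemma measurable_det n (M : T -> 'M[R]_n) :
  measurable_mx M -> measurable_fun setT (fun w => \det (M w)).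
Proof.
move=> mM; rewrite /determinant; apply: measurable_sum => s.
by apply: measurable_funM => //; apply: measurable_prod => i _; apply: mM.
Qed.

(** Cramer's rule. *)
Lemma measurable_invmx n (M : T -> 'M[R]_n) : (forall w, M w \in unitmx) ->
  measurable_mx M -> measurable_mx (fun w => invmx (M w)).
Proof.
move=> Mu mM i j.
have -> : (fun w => invmx (M w) i j) =
    fun w => (\det (M w))^-1 * ((-1) ^+ (j + i) * \det (row' j (col' i (M w)))).
  by apply/funext => w; rewrite /invmx Mu !mxE.
apply: measurable_funM; first exact/measurable_fun_inv/measurable_det.
apply: measurable_funM => //; apply: measurable_det => k l.
by under eq_fun do rewrite !mxE; apply: mM.
Qed.

End MatrixMeasurability.

Section EnkfMeasurability.
Context {dT : measure_display} {T : measurableType dT} {R : realType}.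
Variables (d d0 N : nat) (A : 'M[R]_d) (B : 'M[R]_(d0, d)) (R0 : 'M[R]_d0).
Hypothesis R0_pd : posdefmx R0.

Lemma measurable_sample_mean k (x : 'I_N.+1 -> T -> 'cV[R]_k) :
  (forall i, measurable_mx (x i)) ->
  measurable_mx (fun w => sample_mean (fun i => x i w)).
Proof. by move=> mx; apply: measurable_mxZ; apply: measurable_mx_sum. Qed.

Lemma measurable_sample_cov k (x : 'I_N.+1 -> T -> 'cV[R]_k) :
  (forall i, measurable_mx (x i)) ->
  measurable_mx (fun w => sample_cov (fun i => x i w)).
Proof.
move=> mx; apply: measurable_mxZ; apply: measurable_mx_sum => i.
have mxi : measurable_mx (fun w => x i w - sample_mean (fun i => x i w)).
  by apply: measurable_mxB => //; apply: measurable_sample_mean.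
by apply: measurable_mxM => //; apply: measurable_mx_tr.
Qed.

Lemma measurable_gain (Q : T -> 'M[R]_d) : (forall w, psdmx (Q w)) ->
  measurable_mx Q -> measurable_mx (fun w => gain B R0 (Q w)).
Proof.
move=> Q0 mQ; have mB := @measurable_mx_cst _ T R _ _ B.
have mBt := @measurable_mx_cst _ T R _ _ B^T.
apply: measurable_mxM; first exact: measurable_mxM.
apply: measurable_invmx => [w|]; first exact: innovation_cov_unit.
apply: measurable_mxD; last exact: measurable_mx_cst.
by apply: measurable_mxM => //; apply: measurable_mxM.
Qed.

Lemma measurable_enkf_update (y : T -> 'cV[R]_d0) (v : 'I_N.+1 -> T -> 'cV[R]_d0)
    (x : 'I_N.+1 -> T -> 'cV[R]_d) : measurable_mx y ->
  (forall i, measurable_mx (v i)) -> (forall i, measurable_mx (x i)) ->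
  forall i, measurable_mx
    (fun w => enkf_update B R0 (y w) (fun i => v i w) (fun i => x i w) i).
Proof.
move=> my mv mx i; apply: measurable_mxD => //; apply: measurable_mxM.
  by apply: measurable_gain => [w|]; [apply: psd_sample_cov|apply: measurable_sample_cov].
by apply: measurable_mxB => //; apply: measurable_mxD => //; apply: measurable_mxM.
Qed.

Lemma measurable_enkf (xi0 : 'I_N.+1 -> T -> 'cV[R]_d)
    (cW : nat -> 'I_N.+1 -> T -> 'cV[R]_d) (cV : nat -> 'I_N.+1 -> T -> 'cV[R]_d0)
    (Y : nat -> T -> 'cV[R]_d0) n :
  (forall i, measurable_mx (xi0 i)) ->
  (forall k i, (k < n)%N -> measurable_mx (cW k.+1 i)) ->
  (forall k i, (k < n)%N -> measurable_mx (cV k i)) ->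
  (forall k, (k < n)%N -> measurable_mx (Y k)) ->
  forall i, measurable_mx (fun w => enkf A B R0 (fun i => xi0 i w)
    (fun k i => cW k i w) (fun k i => cV k i w) (fun k => Y k w) n i).
Proof.
move=> mxi mcW mcV mY; elim: n mcW mcV mY => [|n IH] mcW mcV mY i //=.
apply: measurable_mxD; last exact: mcW.
apply: measurable_mxM; first exact: measurable_mx_cst.
apply: measurable_enkf_update; first exact: mY.
  by move=> j; apply: mcV.
by apply: IH => k; [move=> j kn; apply: mcW|move=> j kn; apply: mcV|move=> kn; apply: mY];
  exact: ltnW.
Qed.

Lemma measurable_signal (X0 : T -> 'cV[R]_d) (W : nat -> T -> 'cV[R]_d) n :
  measurable_mx X0 -> (forall k, measurable_mx (W k)) ->
  measurable_mx (fun w => signal A (X0 w) (fun k => W k w) n).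
Proof.
move=> mX mW; elim: n => //= n IH; apply: measurable_mxD => //.
by apply: measurable_mxM => //; apply: measurable_mx_cst.
Qed.

Lemma measurable_observation (X0 : T -> 'cV[R]_d) (W : nat -> T -> 'cV[R]_d)
    (V : nat -> T -> 'cV[R]_d0) n :
  measurable_mx X0 -> (forall k, measurable_mx (W k)) ->
  (forall k, measurable_mx (V k)) ->
  measurable_mx (fun w => observation A B (X0 w) (fun k => W k w) (fun k => V k w) n).
Proof.
move=> mX mW mV; apply: measurable_mxD => //; apply: measurable_mxM.
  exact: measurable_mx_cst.
exact: measurable_signal.
Qed.

End EnkfMeasurability.

(** * Concentration of sample covariances and cross-covariances *)

Section GaussianVectors.
Context {dT : measure_display} {T : measurableType dT} {R : realType}.
Variable P : probability T R.

Lemma orlicz_l1mx m n (M : T -> 'M[R]_(m, n)) (k : 'I_m -> 'I_n -> R) (e : R) :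
  0 < e -> (forall i j, 0 < k i j) ->
  (forall i j, orlicz P (fun w => M w i j) (k i j)) ->
  orlicz P (fun w => l1mx (M w)) (e + \sum_i \sum_j k i j).
Proof.
move=> e0 k0 Mk.
have := @orlicz_sum _ _ _ P _ (index_enum ('I_m * 'I_n)%type)
  (fun p w => M w p.1 p.2) (fun p => k p.1 p.2)
  (fun p => k0 p.1 p.2) (fun p => Mk p.1 p.2) e e0.
rewrite pair_big; apply: orlicz_dom => [w|]; first by rewrite /l1mx pair_big.
by rewrite ltr_pwDl // sumr_ge0 // => p _; apply: ltW.
Qed.

End GaussianVectors.

Section ConcentrationRates.
Context (R : realType) (n : nat) (Sigma : 'M[R]_n).
(** Constants for [orlicz_sample_cov] and [orlicz_weighted_mx]. The leading [1] keeps
    them positive when the sums are empty. *)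
Definition sample_cov_rate : R := 1 + \sum_(i < n) \sum_(j < n) (9 * expR 1 + 8) *
  (qform Sigma (delta_mx i 0 + delta_mx j 0) + qform Sigma (delta_mx i 0) +
   qform Sigma (delta_mx j 0)).

Definition cross_cov_rate m (theta C : R) : R :=
  1 + \sum_(a < m) \sum_(b < n) 2 * C * (Num.sqrt (Sigma b b) * (1 + theta^-1)).

Lemma sample_cov_rate_gt0 : posdefmx Sigma -> 0 < sample_cov_rate.
Proof.
move=> Sigma_pd; have c0 : 0 <= 9 * expR 1 + 8 :> R by rewrite addr_ge0 // mulr_ge0 // expR_ge0.
rewrite ltr_pwDl // sumr_ge0 // => i _; rewrite sumr_ge0 // => j _.
by rewrite mulr_ge0 // !addr_ge0 //; apply: (posdefmx_psd Sigma_pd).2.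
Qed.

Lemma cross_cov_rate_gt0 m (theta C : R) : 0 < theta -> 0 < C ->
  0 < cross_cov_rate m theta C.
Proof.
move=> th0 C0; rewrite ltr_pwDl // sumr_ge0 // => i _; rewrite sumr_ge0 // => j _.
by rewrite !mulr_ge0 ?addr_ge0 ?sqrtr_ge0 ?invr_ge0 ?(ltW th0) ?(ltW C0).
Qed.

End ConcentrationRates.

Section SourceSamples.
Context {dT : measure_display} {T : measurableType dT} {R : realType}.
Variable P : probability T R.
Variables (I : Type) (F : I -> set_system T).
Hypotheses (F_meas : forall i, F i `<=` measurable) (F_setT : forall i, F i setT)
  (F_setI : forall i, setI_closed (F i)) (F_indep : mutually_independent P F).
Variables (n N : nat) (src : 'I_N.+1 -> I) (Z : 'I_N.+1 -> T -> 'cV[R]_n).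
Hypotheses (src_inj : injective src) (Z_src : forall i, F (src i) = sigma_of (Z i)).
Variables (mu : 'cV[R]_n) (Sigma : 'M[R]_n).
Hypotheses (Z_law : forall i, gaussian_vector P (Z i) mu Sigma)
  (Sigma_pd : posdefmx Sigma).
Variable rN : R.
Hypotheses (rN1 : 1 <= rN) (rNE : rN ^+ 2 = N%:R).

Let rN0 : 0 < rN. Proof. exact: lt_le_trans rN1. Qed.

Lemma gaussian_sample_linear (u : 'cV[R]_n) : u != 0 ->
  gaussian_sample P (fun i => others F (src i)) (fun i w => (u^T *m Z i w) 0 0)
    ((u^T *m mu) 0 0) (Num.sqrt (qform Sigma u)).
Proof.
move=> u0; split.
- by rewrite sqrtr_gt0; apply: Sigma_pd.2.
- by move=> i; apply: indep_others => // B mB; rewrite Z_src; apply: sigma_of_linear.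
- by move=> i B mB; apply: (Z_law i).2.
- move=> i j ij; apply: (@measurable_fun_others _ _ _ _ F F_setT _ (src j)).
    by move=> /src_inj e; rewrite e eqxx in ij.
  by move=> B mB; rewrite Z_src; apply: sigma_of_linear.
Qed.

Lemma orlicz_qform_sample_cov (u : 'cV[R]_n) : u != 0 ->
  orlicz P (fun w => qform (sample_cov (fun i => Z i w) - Sigma) u)
    ((9 * expR 1 + 8) * qform Sigma u / rN).
Proof.
move=> u0; have q0 : 0 < qform Sigma u by apply: Sigma_pd.2.
have := orlicz_sample_variance (gaussian_sample_linear u0) rN1 rNE.
rewrite sqr_sqrtr ?(ltW q0) //; apply: orlicz_dom => [w|]; last first.
  by rewrite divr_gt0 // mulr_gt0 // addr_gt0 // mulr_gt0 // expR_gt0.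
rewrite qformD qformN qform_sample_cov le_eqVlt; apply/orP; left; apply/eqP.
congr (`|_ * _ - _|); apply: eq_bigr => i _; congr (_ ^+ 2).
rewrite mulmxBr [LHS]mxE [X in _ + X]mxE; congr (_ - _).
rewrite /sample_mean -scalemxAr mxE mulmx_sumr summxE; congr (_ * _).
Qed.

(** By polarization, the entries are combinations of empirical variances of linear
    forms. *)
Lemma orlicz_sample_cov :
  orlicz P (fun w => l1mx (sample_cov (fun i => Z i w) - Sigma)) (sample_cov_rate Sigma / rN).
Proof.
pose q u := qform Sigma u.
have delta0 (i : 'I_n) : delta_mx i 0 != 0 :> 'cV[R]_n.
  by apply/eqP => /matrixP/(_ i 0); rewrite !mxE !eqxx /= => /eqP; rewrite oner_eq0.
have delta1 (i j : 'I_n) : delta_mx i 0 + delta_mx j 0 != 0 :> 'cV[R]_n.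
  apply/eqP => /matrixP/(_ i 0); rewrite !mxE !eqxx /= => /eqP.
  by rewrite gt_eqF // ltr_pwDl.
have c0 : 0 < 9 * expR 1 + 8 :> R by rewrite addr_gt0 // mulr_gt0 // expR_gt0.
have q0 u : u != 0 -> 0 < (9 * expR 1 + 8) * q u / rN.
  by move=> u0; rewrite divr_gt0 // mulr_gt0 //; apply: Sigma_pd.2.
have rV : 0 < rN^-1 by rewrite invr_gt0.
pose k i j := (9 * expR 1 + 8) * (q (delta_mx i 0 + delta_mx j 0) + q (delta_mx i 0) +
   q (delta_mx j 0)) / rN.
have kE i j : k i j = (9 * expR 1 + 8) * q (delta_mx i 0 + delta_mx j 0) / rN +
    ((9 * expR 1 + 8) * q (delta_mx i 0) / rN + (9 * expR 1 + 8) * q (delta_mx j 0) / rN).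
  by rewrite /k; ring.
have k0 i j : 0 < k i j by rewrite kE !addr_gt0 ?q0.
have -> : sample_cov_rate Sigma / rN = rN^-1 + \sum_i \sum_j k i j.
  rewrite /sample_cov_rate mulrDl mul1r mulr_suml; congr (_ + _).
  by apply: eq_bigr => i _; rewrite mulr_suml.
apply: orlicz_l1mx => // i j.
have O1 := orliczD (q0 _ (delta0 i)) (q0 _ (delta0 j))
  (orlicz_qform_sample_cov (delta0 i)) (orlicz_qform_sample_cov (delta0 j)).
have := orliczD (q0 _ (delta1 i j)) (addr_gt0 (q0 _ (delta0 i)) (q0 _ (delta0 j)))
  (orlicz_qform_sample_cov (delta1 i j)) O1.
rewrite -kE; apply: orlicz_dom => [w|]; last exact: k0.
have sym : (sample_cov (fun i => Z i w) - Sigma)^T = sample_cov (fun i => Z i w) - Sigma.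
  by rewrite linearB /= (psd_sample_cov _).1 Sigma_pd.1.
rewrite (entry_polarize i j sym).
move: (qform _ _) (qform _ _) (qform _ _) => x y z.
rewrite [X in _ <= `|_ + X|]ger0_norm ?addr_ge0 // [leRHS]ger0_norm ?addr_ge0 //.
rewrite normrM ger0_norm ?invr_ge0 //.
have := ler_normB (z - y) x; have := ler_normB z y.
have := normr_ge0 x; have := normr_ge0 y; have := normr_ge0 z; lra.
Qed.

(** Measurability of the weights with respect to every [others F (src j)] expresses
    that they do not depend on the sample. *)
Lemma orlicz_weighted_entry (t : 'I_N.+1 -> T -> R) (theta C : R) (b : 'I_n) :
  mu = 0 ->
  (forall i j, measurable_fun setT (t i : g_sigma_algebraType (others F (src j)) -> R)) ->
  0 < theta -> 1 <= C ->
  (\int[P]_w (expR (theta * (N%:R^-1 * \sum_i t i w ^+ 2)))%:E <= C%:E)%E ->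
  orlicz P (fun w => N%:R^-1 * \sum_i t i w * Z i w b 0)
    (2 * C * (Num.sqrt (Sigma b b) * (1 + theta^-1)) / rN).
Proof.
move=> mu0 mt th0 C1 tC.
have delta0 : delta_mx b 0 != 0 :> 'cV[R]_n.
  by apply/eqP => /matrixP/(_ b 0); rewrite !mxE !eqxx /= => /eqP; rewrite oner_eq0.
have := orlicz_weighted_sum (gaussian_sample_linear delta0) rN1 rNE mt th0 C1 tC.
rewrite qform_delta mu0 mulmx0 mxE.
have -> // : (fun w => N%:R^-1 * \sum_i t i w * (((delta_mx b 0 : 'cV[R]_n)^T *m Z i w) 0 0 - 0)) =
    (fun w => N%:R^-1 * \sum_i t i w * Z i w b 0).
apply/funext => w; congr (_ * _); apply: eq_bigr => i _.
by rewrite subr0 trmx_delta -rowE mxE.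
Qed.

Lemma orlicz_weighted_mx m (M : T -> 'M[R]_(m, n)) (t : 'I_m -> 'I_N.+1 -> T -> R)
    (theta C : R) : mu = 0 ->
  (forall w a b, M w a b = N%:R^-1 * \sum_i t a i w * Z i w b 0) ->
  (forall a i j,
     measurable_fun setT (t a i : g_sigma_algebraType (others F (src j)) -> R)) ->
  0 < theta -> 1 <= C ->
  (forall a, \int[P]_w (expR (theta * (N%:R^-1 * \sum_i t a i w ^+ 2)))%:E <= C%:E)%E ->
  orlicz P (fun w => l1mx (M w)) (cross_cov_rate Sigma m theta C / rN).
Proof.
move=> mu0 ME mt th0 C1 tC.
have C0 : 0 < C by exact: lt_le_trans C1.
have rV : 0 < rN^-1 by rewrite invr_gt0.
pose k (b : 'I_n) := 2 * C * (Num.sqrt (Sigma b b) * (1 + theta^-1)) / rN.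
have k0 b : 0 < k b.
  rewrite divr_gt0 // mulr_gt0 ?mulr_gt0 ?addr_gt0 ?invr_gt0 // sqrtr_gt0 -qform_delta.
  apply: Sigma_pd.2; apply/eqP => /matrixP/(_ b 0); rewrite !mxE !eqxx /= => /eqP.
  by rewrite oner_eq0.
have -> : cross_cov_rate Sigma m theta C / rN = rN^-1 + \sum_(a < m) \sum_b k b.
  rewrite /cross_cov_rate mulrDl mul1r mulr_suml; congr (_ + _).
  by apply: eq_bigr => a _; rewrite mulr_suml.
apply: orlicz_l1mx => // a b; under eq_fun do rewrite ME.
exact: orlicz_weighted_entry.
Qed.

End SourceSamples.

(** * Perturbed Riccati orbits and the ensemble filter *)

Section RiccatiPerturbation.
Context (R : realType) (d d0 : nat).
Variables (A : 'M[R]_d) (B : 'M[R]_(d0, d)) (R1 : 'M[R]_d) (R0 : 'M[R]_d0) (P0 : 'M[R]_d).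
Hypotheses (R1_pd : posdefmx R1) (R0_pd : posdefmx R0) (P0_psd : psdmx P0).

Local Notation Phi := (riccati A B R1 R0).

Definition riccati_defect (p : nat -> 'M[R]_d) (n : nat) : R :=
  if n is k.+1 then l1mx (p k.+1 - Phi (p k)) else l1mx (p 0%N - P0).

(** A perturbed orbit stays close to the exact one: each defect is transported by
    the exponentially stable flow. *)
Lemma riccati_perturbation (rho c : R) (p : nat -> 'M[R]_d) j k :
  (forall n, psdmx (p n)) ->
  (forall n Q1 Q2, psdmx Q1 -> psdmx Q2 ->
    l1mx (iter n Phi Q1 - iter n Phi Q2) <= c * rho ^+ n * l1mx (Q1 - Q2)) ->
  l1mx (iter j Phi (p k) - iter (j + k) Phi P0) <=
  \sum_(i < k.+1) c * rho ^+ (j + k - i) * riccati_defect p i.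
Proof.
move=> p0 stab; elim: k j => [|k IH] j.
  by rewrite big_ord1 /= subn0 addn0; apply: stab.
rewrite big_ord_recr /= addnK.
have -> : iter j Phi (p k.+1) - iter (j + k.+1) Phi P0 =
    (iter j.+1 Phi (p k) - iter (j.+1 + k) Phi P0) +
    (iter j Phi (p k.+1) - iter j Phi (Phi (p k))).
  by rewrite addSnnS iterSr [RHS]addrC addrA subrK.
apply: le_trans (l1mxD _ _) _; apply: lerD; last first.
  by apply: stab => //; apply: psd_riccati.
apply: le_trans (IH j.+1) _; rewrite addSnnS; exact: lexx.
Qed.

Lemma geometric_convolution_le (rho : R) n : 0 < rho < 1 ->
  \sum_(i < n.+1) rho ^+ (n - i) <= (1 - rho)^-1.
Proof.
move=> /andP[rho0 rho1].
rewrite -[leRHS]mul1r ler_pdivlMr ?subr_gt0 //.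
have -> : \sum_(i < n.+1) rho ^+ (n - i) = \sum_(i < n.+1) rho ^+ i.
  rewrite (reindex_inj rev_ord_inj) /=; apply: eq_bigr => i _.
  by rewrite subSS subKn // -ltnS.
rewrite mulrC -opprB mulNr -subrX1 opprB gerBl exprn_ge0 //; exact: ltW.
Qed.

End RiccatiPerturbation.

Section EnkfNoise.
Context (R : realType) (d d0 : nat).
Variables (A : 'M[R]_d) (B : 'M[R]_(d0, d)) (R1 : 'M[R]_d) (R0 : 'M[R]_d0)
  (P0 : 'M[R]_d) (m0 : 'cV[R]_d).
Hypotheses (R1_pd : posdefmx R1) (R0_pd : posdefmx R0) (P0_pd : posdefmx P0)
  (S_pd : posdefmx (Smx B R0)).

Section OneModel.
Context (N : nat) {disp : measure_display} {T : measurableType disp}.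
Variables (P : probability T R)
    (X0 : T -> 'cV[R]_d) (W : nat -> T -> 'cV[R]_d) (V : nat -> T -> 'cV[R]_d0)
    (xi0 : 'I_N.+1 -> T -> 'cV[R]_d) (cW : nat -> 'I_N.+1 -> T -> 'cV[R]_d)
    (cV : nat -> 'I_N.+1 -> T -> 'cV[R]_d0).
Hypothesis model : enkf_sources m0 R1 R0 P0 P X0 W V xi0 cW cV.

Definition source_events (s : source N) : set_system T :=
  match s with
  | Src_X0 => sigma_of X0
  | Src_W n => sigma_of (W n)
  | Src_V n => sigma_of (V n)
  | Src_xi0 i => sigma_of (xi0 i)
  | Src_cW n i => sigma_of (cW n i)
  | Src_cV n i => sigma_of (cV n i)
  end.

Let F := source_events.
Let F_indep : mutually_independent P F := sources_indep model.

Let F_meas s : F s `<=` measurable.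
Proof.
case: s => [|n|n|i|n i|n i]; [exact: (law_X0 model).1|exact: (law_W model n).1|
  exact: (law_V model n).1|exact: (law_xi0 model i).1|exact: (law_cW model n i).1|
  exact: (law_cV model n i).1].
Qed.

Let F_setT s : F s setT.
Proof. by case: s => [|n|n|i|n i|n i]; apply: sigma_of_setT. Qed.

Let F_setI s : setI_closed (F s).
Proof. by case: s => [|n|n|i|n i|n i]; apply: sigma_of_setI. Qed.

Local Notation GT s := (g_sigma_algebraType (others F s)).

Let others_mx s s' n (X : T -> 'cV[R]_n) : s <> s' -> F s' = sigma_of X ->
  @measurable_mx _ (GT s) R _ _ X.
Proof.
move=> ss' FX i j; rewrite (ord1 j).
apply: (measurable_fun_others F_setT ss') => C mC; rewrite FX.
by exists ((fun x : 'cV[R]_n => x i 0) @^-1` C) => //; exact: borel_coord.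
Qed.

Let Y w n := observation A B (X0 w) (fun k => W k w) (fun k => V k w) n.
Let x n w := enkf A B R0 (fun i => xi0 i w)
    (fun k i => cW k i w) (fun k i => cV k i w) (Y w) n.
Let p n w := sample_cov (x n w).
Let z n w := enkf_hat A B R0 (fun i => xi0 i w)
    (fun k i => cW k i w) (fun k i => cV k i w) (Y w) n.

Definition particle_source (s : source N) : Prop :=
  match s with Src_cW _ _ => True | Src_cV _ _ => True | _ => False end.

Let measurable_Y s n : particle_source s -> @measurable_mx _ (GT s) R _ _ (fun w => Y w n).
Proof.
move=> sp; apply: (@measurable_observation _ (GT s)).
- by apply: (@others_mx s (Src_X0 N)) => // e; rewrite e in sp.
- by move=> k; apply: (@others_mx s (Src_W N k)) => // e; rewrite e in sp.
- by move=> k; apply: (@others_mx s (Src_V N k)) => // e; rewrite e in sp.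
Qed.

(** The particles at time [n] are functions of the noises already used. *)
Let measurable_x s n i : particle_source s ->
  (forall k j, (k < n)%N -> s <> Src_cW k.+1 j) ->
  (forall k j, (k < n)%N -> s <> Src_cV k j) ->
  @measurable_mx _ (GT s) R _ _ (fun w => x n w i).
Proof.
move=> sp sW sV; apply: (@measurable_enkf _ (GT s)) => //.
- by move=> j; apply: (@others_mx s (Src_xi0 j)) => // e; rewrite e in sp.
- by move=> k j kn; apply: (@others_mx s (Src_cW k.+1 j)) => //; apply: sW.
- by move=> k j kn; apply: (@others_mx s (Src_cV k j)) => //; apply: sV.
- by move=> k _; apply: measurable_Y.
Qed.

Let measurable_z s n i : particle_source s ->
  (forall k j, (k < n)%N -> s <> Src_cW k.+1 j) ->
  (forall k j, (k <= n)%N -> s <> Src_cV k j) ->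
  @measurable_mx _ (GT s) R _ _ (fun w => z n w i).
Proof.
move=> sp sW sV; apply: (@measurable_enkf_update _ (GT s)) => //.
- exact: measurable_Y.
- by move=> j; apply: (@others_mx s (Src_cV n j)) => //; apply: sV.
- by move=> j; apply: measurable_x => // k l /ltnW; apply: sV.
Qed.

Variable rN : R.
Hypotheses (rN1 : 1 <= rN) (rNE : rN ^+ 2 = N%:R).
Let rN0 : 0 < rN. Proof. exact: lt_le_trans rN1. Qed.

Variable cg : R.
Hypotheses (cg0 : 0 < cg)
  (Hcg : forall Q, psdmx Q -> l1mx (update_cov B R0 Q) <= cg).

Let psd_p n w : psdmx (p n w). Proof. exact: psd_sample_cov. Qed.

Lemma initial_noise :
  orlicz P (fun w => l1mx (p 0 w - P0)) (sample_cov_rate P0 / rN).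
Proof.
apply: (orlicz_sample_cov F_meas F_setT F_setI F_indep (src := @Src_xi0 N)) => //.
- by move=> i j [].
- exact: law_xi0 model.
Qed.

Lemma observation_cov_noise n :
  orlicz P (fun w => l1mx (sample_cov (fun i => cV n i w) - R0)) (sample_cov_rate R0 / rN).
Proof.
apply: (orlicz_sample_cov F_meas F_setT F_setI F_indep (src := @Src_cV N n)) => //.
- by move=> i j [].
- exact: law_cV model n.
Qed.

Lemma signal_cov_noise n :
  orlicz P (fun w => l1mx (sample_cov (fun i => cW n i w) - R1)) (sample_cov_rate R1 / rN).
Proof.
apply: (orlicz_sample_cov F_meas F_setT F_setI F_indep (src := @Src_cW N n)) => //.
- by move=> i j [].
- exact: law_cW model n.
Qed.

(** The weights are the deviations multiplied by [Ahat]; by Joseph's form their second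
    moment [Ahat p Ahat'] is at most [update_cov p], which is bounded. *)
Lemma observation_cross_noise n :
  orlicz P (fun w => l1mx (Ahat B R0 (p n w) *m cross_cov (x n w) (fun i => cV n i w)))
    (cross_cov_rate R0 d 1 (expR cg) / rN).
Proof.
pose t (a : 'I_d) i w := (Ahat B R0 (p n w) *m (x n w i - sample_mean (x n w))) a 0.
have inj : injective (@Src_cV N n) by move=> i j [].
apply: (orlicz_weighted_mx F_meas F_setT F_setI F_indep inj (Z := cV n)
  (fun=> erefl) (law_cV model n) R0_pd rN1 rNE (t := t)) => //.
- move=> w a b; rewrite cross_covE -scalemxAr mxE mulmx_sumr summxE; congr (_ * _).
  by apply: eq_bigr => i _; rewrite mulmxA mxE big_ord1 [(_^T) _ _]mxE.
- move=> a i j; have mx k : @measurable_mx _ (GT (Src_cV n j)) R _ _ (fun w => x n w k).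
    apply: measurable_x => // k' l kn.
    by case=> e _; rewrite e ltnn in kn.
  have mp : @measurable_mx _ (GT (Src_cV n j)) R _ _ (p n).
    exact: (@measurable_sample_cov _ (GT (Src_cV n j))).
  suff : @measurable_mx _ (GT (Src_cV n j)) R _ _
     (fun w => Ahat B R0 (p n w) *m (x n w i - sample_mean (x n w))) by move/(_ a 0).
  apply: (@measurable_mxM _ (GT (Src_cV n j))).
    apply: (@measurable_mxB _ (GT (Src_cV n j))); first exact: measurable_mx_cst.
    apply: (@measurable_mxM _ (GT (Src_cV n j))); last exact: measurable_mx_cst.
    exact: (@measurable_gain _ (GT (Src_cV n j))).
  apply: (@measurable_mxB _ (GT (Src_cV n j))) => //.
  exact: (@measurable_sample_mean _ (GT (Src_cV n j))).
- by rewrite -expR0 ler_expR ltW.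
- move=> a; apply: (@le_trans _ _ (\int[P]_w (cst (expR cg)%:E w))%E); last first.
    by rewrite integral_cst //= probability_setT mule1.
  apply: le_ge0_integral => w; first by rewrite lee_fin expR_ge0.
  rewrite /= lee_fin ler_expR mul1r.
  have -> : N%:R^-1 * \sum_i t a i w ^+ 2 =
      qform (Ahat B R0 (p n w) *m p n w *m (Ahat B R0 (p n w))^T) (delta_mx a 0).
    rewrite qform_congr /p qform_sample_cov; congr (_ * _); apply: eq_bigr => i _.
    by rewrite trmx_mul trmxK trmx_delta -mulmxA -rowE mxE.
  apply: le_trans (_ : qform (update_cov B R0 (p n w)) (delta_mx a 0) <= _).
    rewrite (update_cov_joseph _ R0_pd (psd_p n w)) qformD lerDl.
    exact: (psdmx_congr _ (posdefmx_psd R0_pd)).2.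
  rewrite qform_delta; apply: le_trans (ler_norm _) _.
  by apply: le_trans (entry_le_l1mx _ _ _) (Hcg (psd_p n w)).
Qed.

(** The weights of the second cross term are the updated deviations: their second
    moment is the updated sample covariance, bounded up to the first noise. *)
Lemma signal_cross_noise n (k1 : R) : 0 < k1 ->
  orlicz P (fun w => l1mx (sample_cov (z n w) - update_cov B R0 (p n w))) (k1 / rN) ->
  orlicz P (fun w => l1mx (cross_cov (z n w) (fun i => cW n.+1 i w)))
    (cross_cov_rate R1 d k1^-1 (2 * expR (cg / k1)) / rN).
Proof.
move=> k10 Oz.
have k1V : 0 < k1^-1 by rewrite invr_gt0.
have {}Oz : orlicz P (fun w => l1mx (sample_cov (z n w) - update_cov B R0 (p n w))) k1.
  apply: orlicz_mono Oz; first by rewrite divr_gt0.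
  by rewrite ler_pdivrMr // ler_peMr // ltW.
pose t (a : 'I_d) i w := (z n w i - sample_mean (z n w)) a 0.
have inj : injective (@Src_cW N n.+1) by move=> i j [].
apply: (orlicz_weighted_mx F_meas F_setT F_setI F_indep inj (Z := cW n.+1)
  (fun=> erefl) (law_cW model n.+1) R1_pd rN1 rNE (t := t)) => //.
- by move=> w a b; rewrite cross_cov_entry.
- move=> a i j; have mz k : @measurable_mx _ (GT (Src_cW n.+1 j)) R _ _ (fun w => z n w k).
    apply: measurable_z => // k' l kn.
    by case=> e _; rewrite e ltnn in kn.
  suff : @measurable_mx _ (GT (Src_cW n.+1 j)) R _ _
     (fun w => z n w i - sample_mean (z n w)) by move/(_ a 0).
  apply: (@measurable_mxB _ (GT (Src_cW n.+1 j))) => //.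
  exact: (@measurable_sample_mean _ (GT (Src_cW n.+1 j))).
- have : 1 <= expR (cg / k1) by rewrite -expR0 ler_expR divr_ge0 // ltW.
  lra.
- move=> a; have [g mg [gz g2]] := Oz.
  have e0 := expR_ge0 (cg / k1).
  have g0 w : 0 <= g w by apply: le_trans (gz w); apply: expR_ge0.
  apply: (@le_trans _ _ (\int[P]_w ((expR (cg / k1))%:E * (g w)%:E))%E); last first.
    rewrite ge0_integralZl_EFin //; last 2 first.
    - by move=> w _; rewrite lee_fin.
    - by apply/measurable_EFinP.
    by rewrite [2 * _]mulrC [leRHS]EFinM lee_wpmul2l.
  apply: le_ge0_integral => w; first by rewrite lee_fin expR_ge0.
  rewrite -EFinM lee_fin -sample_cov_diag.
  apply: (@le_trans _ _ (expR (cg / k1) *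
      expR (`|l1mx (sample_cov (z n w) - update_cov B R0 (p n w))| / k1))); last first.
    by rewrite ler_wpM2l.
  rewrite -expRD ler_expR -mulrDl mulrC ler_pM2r //.
  have -> : sample_cov (z n w) a a = update_cov B R0 (p n w) a a +
      (sample_cov (z n w) - update_cov B R0 (p n w)) a a.
    by move: (sample_cov (z n w)) (update_cov B R0 (p n w)) => C1 C2; rewrite !mxE; ring.
  apply: lerD; apply: le_trans (ler_norm _) _.
    by apply: le_trans (entry_le_l1mx _ _ _) (Hcg (psd_p n w)).
  by apply: le_trans (entry_le_l1mx _ _ _) (ler_norm _).
Qed.

Lemma update_noise n (c : R) : 0 < c ->
  (forall y v (x : 'I_N.+1 -> 'cV[R]_d),
  l1mx (sample_cov (enkf_update B R0 y v x) - update_cov B R0 (sample_cov x)) <=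
  c * (l1mx (sample_cov v - R0) + l1mx (Ahat B R0 (sample_cov x) *m cross_cov x v))) ->
  orlicz P (fun w => l1mx (sample_cov (z n w) - update_cov B R0 (p n w)))
    (c * (sample_cov_rate R0 + cross_cov_rate R0 d 1 (expR cg)) / rN).
Proof.
move=> c0 Hc.
have k1 : 0 < sample_cov_rate R0 / rN by rewrite divr_gt0 // sample_cov_rate_gt0.
have k2 : 0 < cross_cov_rate R0 d 1 (expR cg) / rN.
  by rewrite divr_gt0 // cross_cov_rate_gt0 // expR_gt0.
have := orliczZ c0 (addr_gt0 k1 k2)
  (orliczD k1 k2 (observation_cov_noise n) (observation_cross_noise n)).
rewrite -mulrDl mulrA; apply: orlicz_dom => [w|]; last first.
  by rewrite divr_gt0 // mulr_gt0 // addr_gt0 ?sample_cov_rate_gt0 // cross_cov_rate_gt0 // expR_gt0.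
rewrite ger0_norm ?l1mx_ge0 //; apply: le_trans (Hc _ _ _) _.
apply: le_trans (ler_norm _); rewrite ler_pM2l //.
by apply: lerD; apply: ler_norm.
Qed.

Lemma prediction_noise n (c k1 : R) : 0 < c -> 0 < k1 ->
  (forall y v w (x : 'I_N.+1 -> 'cV[R]_d),
  let z := enkf_update B R0 y v x in
  l1mx (sample_cov (fun i => A *m z i + w i) - riccati A B R1 R0 (sample_cov x)) <=
  c * (l1mx (sample_cov v - R0) + l1mx (Ahat B R0 (sample_cov x) *m cross_cov x v) +
       l1mx (sample_cov w - R1) + l1mx (cross_cov z w))) ->
  orlicz P (fun w => l1mx (sample_cov (z n w) - update_cov B R0 (p n w))) (k1 / rN) ->
  orlicz P (fun w => l1mx (p n.+1 w - riccati A B R1 R0 (p n w)))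
    (c * (sample_cov_rate R0 + cross_cov_rate R0 d 1 (expR cg) +
       sample_cov_rate R1 + cross_cov_rate R1 d k1^-1 (2 * expR (cg / k1))) / rN).
Proof.
move=> c0 k10 Hc Oz.
have e0 : 0 < 2 * expR (cg / k1) by rewrite mulr_gt0 // expR_gt0.
have k1V : 0 < k1^-1 by rewrite invr_gt0.
have b1 := sample_cov_rate_gt0 R0_pd.
have b2 := cross_cov_rate_gt0 R0 d ltr01 (expR_gt0 cg).
have b3 := sample_cov_rate_gt0 R1_pd.
have b4 := cross_cov_rate_gt0 R1 d k1V e0.
have a1 : 0 < sample_cov_rate R0 / rN by rewrite divr_gt0.
have a2 : 0 < cross_cov_rate R0 d 1 (expR cg) / rN by rewrite divr_gt0.
have a3 : 0 < sample_cov_rate R1 / rN by rewrite divr_gt0.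
have a4 : 0 < cross_cov_rate R1 d k1^-1 (2 * expR (cg / k1)) / rN by rewrite divr_gt0.
have O1 := orliczD a1 a2 (observation_cov_noise n) (observation_cross_noise n).
have O2 := orliczD (addr_gt0 a1 a2) a3 O1 (signal_cov_noise n.+1).
have O3 := orliczD (addr_gt0 (addr_gt0 a1 a2) a3) a4 O2 (signal_cross_noise k10 Oz).
have := orliczZ c0 (addr_gt0 (addr_gt0 (addr_gt0 a1 a2) a3) a4) O3.
rewrite -!mulrDl mulrA; apply: orlicz_dom => [w|]; last first.
  by rewrite divr_gt0 // mulr_gt0 // addr_gt0 // addr_gt0 // addr_gt0.
rewrite ger0_norm ?l1mx_ge0 //; apply: le_trans (Hc _ _ _ _) _.
apply: le_trans (ler_norm _); rewrite ler_pM2l //.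
have norms (a b e f : R) : a + b + e + f <= `| `| `|a| + `|b| | + `|e| | + `|f|.
  do 2![apply: lerD; last exact: ler_norm; apply: le_trans (ler_norm _)].
  by apply: lerD; apply: ler_norm.
exact: norms.
Qed.

End OneModel.

(** The constants of the one-step estimates come from bounds that hold for all positive
    semi-definite matrices, so one constant serves all times and ensemble sizes. *)
Lemma enkf_noise : exists2 c : R, 0 < c & forall N : nat, (0 < N)%N ->
  forall (disp : measure_display) (T : measurableType disp) (P : probability T R)
    (X0 : T -> 'cV[R]_d) (W : nat -> T -> 'cV[R]_d) (V : nat -> T -> 'cV[R]_d0)
    (xi0 : 'I_N.+1 -> T -> 'cV[R]_d) (cW : nat -> 'I_N.+1 -> T -> 'cV[R]_d)
    (cV : nat -> 'I_N.+1 -> T -> 'cV[R]_d0),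
  enkf_sources m0 R1 R0 P0 P X0 W V xi0 cW cV ->
  let Y w n := observation A B (X0 w) (fun k => W k w) (fun k => V k w) n in
  let p n w := sample_cov (enkf A B R0 (fun i => xi0 i w)
    (fun k i => cW k i w) (fun k i => cV k i w) (Y w) n) in
  let phat n w := sample_cov (enkf_hat A B R0 (fun i => xi0 i w)
    (fun k i => cW k i w) (fun k i => cV k i w) (Y w) n) in
  forall n,
  orlicz P (fun w => l1mx (phat n w - update_cov B R0 (p n w))) (c / Num.sqrt N%:R) /\
  orlicz P (fun w => riccati_defect A B R1 R0 P0 (p^~ w) n) (c / Num.sqrt N%:R).
Proof.
have [cg cg0 Hcg] := update_cov_bounded R0_pd S_pd.
have [c1 c10 Hc1] := enkf_update_noise R0_pd S_pd.
have [c2 c20 Hc2] := enkf_prediction_noise A R1 R0_pd S_pd.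
pose r1 := sample_cov_rate R0 + cross_cov_rate R0 d 1 (expR cg).
have r10 : 0 < r1 by rewrite addr_gt0 ?sample_cov_rate_gt0 ?cross_cov_rate_gt0 ?expR_gt0.
pose k1 := c1 * r1; have k10 : 0 < k1 by rewrite mulr_gt0.
pose k2 := c2 * (r1 + sample_cov_rate R1 + cross_cov_rate R1 d k1^-1 (2 * expR (cg / k1))).
have k20 : 0 < k2.
  have e0 : 0 < 2 * expR (cg / k1) by rewrite mulr_gt0 // expR_gt0.
  have k1V : 0 < k1^-1 by rewrite invr_gt0.
  have b3 := sample_cov_rate_gt0 R1_pd.
  have b4 := cross_cov_rate_gt0 R1 d k1V e0.
  by rewrite mulr_gt0 // addr_gt0 // addr_gt0.
have k30 : 0 < sample_cov_rate P0 by apply: sample_cov_rate_gt0.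
exists (k1 + k2 + sample_cov_rate P0) => [|N N0 disp T P X0 W V xi0 cW cV model Y p phat n].
  by rewrite addr_gt0 // addr_gt0.
have NR0 : 0 < N%:R :> R by rewrite ltr0n.
set rN := Num.sqrt N%:R.
have rN0 : 0 < rN by rewrite sqrtr_gt0.
have rNE : rN ^+ 2 = N%:R by rewrite sqr_sqrtr // ltW.
have rN1 : 1 <= rN by rewrite -[leLHS]sqrtr1 ler_sqrt // ler1n.
have Ou m : orlicz P (fun w => l1mx (phat m w - update_cov B R0 (p m w))) (k1 / rN).
  exact: (update_noise model rN1 rNE cg0 Hcg m c10 (Hc1 N)).
split.
  apply: orlicz_mono (Ou n); first by rewrite divr_gt0.
  by rewrite ler_pM2r ?invr_gt0 // -addrA lerDl addr_ge0 // ltW.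
case: n => [|n] /=.
  apply: orlicz_mono (initial_noise model rN1 rNE); first by rewrite divr_gt0.
  by rewrite ler_pM2r ?invr_gt0 // lerDr addr_ge0 // ltW.
apply: orlicz_mono (prediction_noise model rN1 rNE cg0 Hcg c20 k10 (Hc2 N) (Ou n)).
  by rewrite divr_gt0.
by rewrite ler_pM2r ?invr_gt0 // -/r1 -/k2 addrAC lerDr addr_ge0 // ltW.
Qed.

(** The error of the filter at time [n] collects the past noises with geometric
    weights, whence a bound uniform in time. *)
Lemma enkf_error : exists2 c : R, 0 < c & forall N : nat, (0 < N)%N ->
  forall (disp : measure_display) (T : measurableType disp) (P : probability T R)
    (X0 : T -> 'cV[R]_d) (W : nat -> T -> 'cV[R]_d) (V : nat -> T -> 'cV[R]_d0)
    (xi0 : 'I_N.+1 -> T -> 'cV[R]_d) (cW : nat -> 'I_N.+1 -> T -> 'cV[R]_d)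
    (cV : nat -> 'I_N.+1 -> T -> 'cV[R]_d0),
  enkf_sources m0 R1 R0 P0 P X0 W V xi0 cW cV ->
  let Y w n := observation A B (X0 w) (fun k => W k w) (fun k => V k w) n in
  let p n w := sample_cov (enkf A B R0 (fun i => xi0 i w)
    (fun k i => cW k i w) (fun k i => cV k i w) (Y w) n) in
  let phat n w := sample_cov (enkf_hat A B R0 (fun i => xi0 i w)
    (fun k i => cW k i w) (fun k i => cV k i w) (Y w) n) in
  forall n,
  orlicz P (fun w => l1mx (phat n w - kalman_cov_hat A B R1 R0 P0 n))
    (c / Num.sqrt N%:R) /\
  orlicz P (fun w => l1mx (gain B R0 (p n w) - gain B R0 (kalman_cov A B R1 R0 P0 n)))
    (c / Num.sqrt N%:R).
Proof.
have P0_psd := posdefmx_psd P0_pd.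
have [k k0 noise] := enkf_noise.
have [rho rho01 [c c0 stab]] := riccati_stability A R1_pd R0_pd S_pd.
have [rho0 rho1] := andP rho01.
have [cu cu0 lipU] := update_cov_lipschitz R0_pd S_pd.
have [cK cK0 lipK] := gain_lipschitz R0_pd S_pd.
pose D := k * (1 + c / (1 - rho)).
have D0 : 0 < D by rewrite mulr_gt0 // addr_gt0 // divr_gt0 // subr_gt0.
exists (k + cu * D + cK * D) => [|N N0 disp T P X0 W V xi0 cW cV model Y p phat n].
  by rewrite !addr_gt0 // mulr_gt0.
have NR0 : 0 < N%:R :> R by rewrite ltr0n.
have := noise N N0 disp T P X0 W V xi0 cW cV model; rewrite /= -/Y -/p -/phat => {}noise.
set rN := Num.sqrt N%:R in noise *.
have rN0 : 0 < rN by rewrite sqrtr_gt0.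
have krN : 0 < k / rN by rewrite divr_gt0.
have psd_p m w : psdmx (p m w) by apply: psd_sample_cov.
pose K m := kalman_cov A B R1 R0 P0 m.
have psd_K m : psdmx (K m) by apply: psd_iter_riccati.
have err : orlicz P (fun w => l1mx (p n w - K n)) (D / rN).
  pose f (i : 'I_n.+1) w := c * rho ^+ (n - i) * riccati_defect A B R1 R0 P0 (p^~ w) i.
  have cr0 (i : 'I_n.+1) : 0 < c * rho ^+ (n - i) by rewrite mulr_gt0 // exprn_gt0.
  have Of i : orlicz P (f i) (c * rho ^+ (n - i) * (k / rN)).
    exact: (orliczZ (cr0 i) krN (noise i).2).
  have := orlicz_sum (index_enum 'I_n.+1) (fun i => mulr_gt0 (cr0 i) krN) Of krN.
  move=> Osum; have Dk : k / rN + \sum_(i < n.+1) c * rho ^+ (n - i) * (k / rN) <= D / rN.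
    rewrite -mulr_suml -mulr_sumr.
    have := @geometric_convolution_le R rho n rho01; rewrite -(ler_pM2l c0) => le.
    have -> : D / rN = k / rN + c / (1 - rho) * (k / rN) by rewrite /D; ring.
    by rewrite lerD2l ler_pM2r.
  apply: (@orlicz_mono _ _ _ _ _ (k / rN + \sum_(i < n.+1) c * rho ^+ (n - i) * (k / rN))) => //.
    by rewrite ltr_pwDl // sumr_ge0 // => i _; rewrite ltW // mulr_gt0.
  apply: orlicz_dom Osum => [w|]; last first.
    by rewrite ltr_pwDl // sumr_ge0 // => i _; rewrite ltW // mulr_gt0.
  rewrite ger0_norm ?l1mx_ge0 //; apply: le_trans (ler_norm _).
  have := @riccati_perturbation R d d0 A B R1 R0 P0 R1_pd R0_pd P0_psd rho c (p^~ w) 0 n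
    (psd_p^~ w) stab.
  move/le_trans; apply; apply: ler_sum => i _; exact: ler_norm.
have DrN : 0 < D / rN by rewrite divr_gt0.
split.
  have O1 := orliczD krN (mulr_gt0 cu0 DrN) (noise n).1 (orliczZ cu0 DrN err).
  apply: (@orlicz_mono _ _ _ _ _ (k / rN + cu * (D / rN))); first by rewrite addr_gt0 // mulr_gt0.
    by rewrite mulrA -mulrDl ler_pM2r ?invr_gt0 // lerDl mulr_ge0 // ltW.
  apply: orlicz_dom O1 => [w|]; last by rewrite addr_gt0 // mulr_gt0.
  rewrite ger0_norm ?l1mx_ge0 //.
  rewrite [leRHS]ger0_norm ?addr_ge0 //.
  have -> : phat n w - kalman_cov_hat A B R1 R0 P0 n =
      (phat n w - update_cov B R0 (p n w)) + (update_cov B R0 (p n w) - update_cov B R0 (K n)).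
    by rewrite addrA subrK.
  apply: le_trans (l1mxD _ _) _; apply: lerD; first exact: ler_norm.
  by apply: le_trans (ler_norm _); apply: lipU.
apply: (@orlicz_mono _ _ _ _ _ (cK * (D / rN))); first by rewrite mulr_gt0.
  rewrite mulrA ler_pM2r ?invr_gt0 // lerDr; apply: addr_ge0 (ltW k0) _.
  exact: mulr_ge0 (ltW cu0) (ltW D0).
apply: orlicz_dom (orliczZ cK0 DrN err) => [w|]; last by rewrite mulr_gt0.
rewrite ger0_norm ?l1mx_ge0 //; apply: le_trans (ler_norm _); exact: lipK.
Qed.

End EnkfNoise.

Theorem corollary2p2 (R : realType) (d d0 : nat)
  (d_gt0 : (0 < d)%N) (d0_gt0 : (0 < d0)%N)
  (A : 'M[R]_d) (B : 'M[R]_(d0, d))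
  (R1 : 'M[R]_d) (R0 : 'M[R]_d0) (P0 : 'M[R]_d) (m0 : 'cV[R]_d)
  (R1_pd : posdefmx R1) (R0_pd : posdefmx R0) (P0_pd : posdefmx P0)
  (S_pd : posdefmx (Smx B R0))
  (nrm : forall m n : nat, 'M[R]_(m, n) -> R)
  (nrmP : forall m n : nat, is_mx_norm (nrm m n))
  (r : R) (r_ge1 : 1 <= r) :
  exists c : R, forall N : nat, (d < N.+1)%N ->
  forall (disp : measure_display) (T : measurableType disp)
    (P : probability T R)
    (X0 : T -> 'cV[R]_d) (W : nat -> T -> 'cV[R]_d) (V : nat -> T -> 'cV[R]_d0)
    (xi0 : 'I_N.+1 -> T -> 'cV[R]_d) (cW : nat -> 'I_N.+1 -> T -> 'cV[R]_d)
    (cV : nat -> 'I_N.+1 -> T -> 'cV[R]_d0),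
  enkf_sources m0 R1 R0 P0 P X0 W V xi0 cW cV ->
  let Y w n := observation A B (X0 w) (fun k => W k w) (fun k => V k w) n in
  let p n w := sample_cov (enkf A B R0 (fun i => xi0 i w)
    (fun k i => cW k i w) (fun k i => cV k i w) (Y w) n) in
  let phat n w := sample_cov (enkf_hat A B R0 (fun i => xi0 i w)
    (fun k i => cW k i w) (fun k i => cV k i w) (Y w) n) in
  (ereal_sup [set
     maxe
       (Lr_norm P r (fun w =>
          nrm d d (phat n w - kalman_cov_hat A B R1 R0 P0 n)%R))
       (Lr_norm P r (fun w =>
          nrm d d0 (gain B R0 (p n w) -
                    gain B R0 (kalman_cov A B R1 R0 P0 n))%R))
     | n in [set: nat]]
   <= (c / Num.sqrt N%:R)%:E)%E.
Proof.
have [c c0 err] := enkf_error A m0 R1_pd R0_pd P0_pd S_pd.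
have [b b0 nb] := is_mx_norm_le_l1mx (nrmP d d).
have [b' b'0 nb'] := is_mx_norm_le_l1mx (nrmP d d0).
have [a a0 La] := orlicz_Lr r_ge1.
exists (a * ((b + b') * c)) => N dN disp T P X0 W V xi0 cW cV model; cbv zeta.
have N0 : (0 < N)%N by apply: leq_trans d_gt0 _; rewrite -ltnS.
have rN0 : 0 < Num.sqrt N%:R :> R by rewrite sqrtr_gt0 ltr0n.
have crN : 0 < c / Num.sqrt N%:R by rewrite divr_gt0.
have bb : 0 < b + b' by rewrite addr_gt0.
apply: ge_ereal_sup => _ [n _ <-].
have [ephat eK] := err N N0 disp T P X0 W V xi0 cW cV model n.
have fin m k (M : T -> 'M[R]_(m, k)) e : 0 < e -> e <= b + b' ->
   (forall M, nrm m k M <= e * l1mx M) ->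
   orlicz P (fun w => l1mx (M w)) (c / Num.sqrt N%:R) ->
   (Lr_norm P r (fun w => nrm m k (M w)) <= (a * ((b + b') * c) / Num.sqrt N%:R)%:E)%E.
  move=> e0 eb ne O.
  have -> : a * ((b + b') * c) / Num.sqrt N%:R = a * ((b + b') * (c / Num.sqrt N%:R)).
    by ring.
  apply: La; first by rewrite mulr_gt0.
  apply: orlicz_dom (orliczZ bb crN O) => [w|]; last by rewrite mulr_gt0.
  rewrite (ger0_norm (mx_norm_ge0 (nrmP m k) _)); apply: le_trans (ne _) _.
  by apply: le_trans (ler_norm _); rewrite ler_wpM2r ?l1mx_ge0.
rewrite ge_max; apply/andP; split.
- by apply: (fin _ _ _ b) => //; rewrite lerDl ltW.
- by apply: (fin _ _ _ b') => //; rewrite lerDr ltW.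
Qed.
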